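(* Let $p$ be a prime. Any S-ring over a finite cyclic $p$-group is separable.
   Context: An S-ring over a finite group $G$ is a subring $\mathcal{A}$ of $\mathbb{Z}G$ for which there is a partition $\mathcal{S}(\mathcal{A})$ of $G$ with $\{1_G\}\in\mathcal{S}(\mathcal{A})$, closed under $X\mapsto X^{-1}$, such that $\mathcal{A}$ is the $\mathbb{Z}$-span of the elements $\sum_{x\in X}x$, $X\in\mathcal{S}(\mathcal{A})$. Classes of the partition are called basic sets. A similarity $\varphi:\mathcal{A}\to\mathcal{A}'$ of S-rings over $G$, $G'$ is a ring isomorphism inducing a bijection $X\mapsto X^\varphi$ between basic sets. $\mathrm{Iso}(\mathcal{A},\mathcal{A}',\varphi)$ is the set of bijections $f:G\to G'$ with $f(Xy)=X^\varphi f(y)$ for all basic sets $X$ of $\mathcal{A}$ and all $y\in G$. An S-ring $\mathcal{A}$ over a cyclic group is separable if $\mathrm{Iso}(\mathcal{A},\mathcal{A}',\varphi)\ne\varnothing$ for every S-ring $\mathcal{A}'$ over a finite cyclic group $G'$ and every similarity $\varphi:\mathcal{A}\to\mathcal{A}'$. *)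

(* Defs.v *)
From HB Require Import structures.
From mathcomp Require Import all_boot all_order all_fingroup all_algebra all_solvable.
Set Implicit Arguments.
Unset Strict Implicit.
Unset Printing Implicit Defensive.
Import GroupScope GRing.Theory.
Local Open Scope ring_scope.

(* A finite group is the whole of a finGroupType.  An element of Z[G] is its
   family of coefficients; the product is convolution, whereas the product of
   {ffun gT -> int} is pointwise, which is why an alias is needed. *)
Definition zgroup_ring (gT : finGroupType) : Type := {ffun gT -> int}.

Section GroupRing.
Variable gT : finGroupType.
Implicit Types (a b c : zgroup_ring gT) (g h : gT).

HB.instance Definition _ := GRing.Zmodule.copy (zgroup_ring gT) {ffun gT -> int}.

Definition zgr_one : zgroup_ring gT := [ffun g => (g == 1%g)%:R].
Definition zgr_mul a b : zgroup_ring gT :=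
  [ffun g => \sum_h a h * b (h^-1 * g)%g].

Fact zgr_mulA : associative zgr_mul.
Proof.
move=> a b c; apply/ffunP=> g; rewrite !ffunE.
under eq_bigr do rewrite ffunE mulr_sumr.
under [RHS]eq_bigr do rewrite ffunE mulr_suml.
rewrite [RHS]exchange_big; apply: eq_bigr => h _ /=.
rewrite [RHS](reindex_inj (mulgI h)) /=; apply: eq_bigr => k _.
by rewrite mulKg invMg mulgA mulrA.
Qed.

Fact zgr_mul1r : left_id zgr_one zgr_mul.
Proof.
move=> a; apply/ffunP=> g; rewrite ffunE (bigD1 1%g) //= big1 => [|h /negPf nh].
  by rewrite ffunE eqxx invg1 mul1g mul1r addr0.
by rewrite ffunE nh mul0r.
Qed.

Fact zgr_mulr1 : right_id zgr_one zgr_mul.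
Proof.
move=> a; apply/ffunP=> g; rewrite ffunE (bigD1 g) //= big1 => [|h nh].
  by rewrite ffunE mulVg eqxx mulr1 addr0.
by rewrite ffunE -eq_mulVg1 (negPf nh) mulr0.
Qed.

Fact zgr_mulDl : left_distributive zgr_mul +%R.
Proof.
move=> a b c; apply/ffunP=> g; rewrite !ffunE -big_split.
by apply: eq_bigr => h _; rewrite ffunE mulrDl.
Qed.

Fact zgr_mulDr : right_distributive zgr_mul +%R.
Proof.
move=> a b c; apply/ffunP=> g; rewrite !ffunE -big_split.
by apply: eq_bigr => h _; rewrite ffunE mulrDr.
Qed.

Fact zgr_one_neq0 : zgr_one != 0.
Proof. by apply/eqP=> /ffunP/(_ 1%g); rewrite !ffunE eqxx. Qed.

HB.instance Definition _ := GRing.Zmodule_isNzRing.Build (zgroup_ring gT)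
  zgr_mulA zgr_mul1r zgr_mulr1 zgr_mulDl zgr_mulDr zgr_one_neq0.

(* The element \sum_(x in X) x of Z[G]. *)
Definition set_sum (X : {set gT}) : zgroup_ring gT := [ffun g => (g \in X)%:R].

End GroupRing.

(* The partition is determined by the subring, so it may be carried as data. *)
Record sring (gT : finGroupType) := SRing {
  sring_set : {pred zgroup_ring gT};
  basic_sets : {set {set gT}};
  sring_subring : subring_closed sring_set;
  sring_partition : partition basic_sets [set: gT];
  sring_basic1 : [set 1%g] \in basic_sets;
  sring_basicV : forall X, X \in basic_sets -> X^-1%g \in basic_sets;
  sring_span : forall a, a \in sring_set <->
    exists c : {set gT} -> int, a = \sum_(X in basic_sets) set_sum X *~ c X
}.

HB.instance Definition _ (gT : finGroupType) (A : sring gT) :=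
  GRing.isSubringClosed.Build (zgroup_ring gT) (sring_set A) (sring_subring A).

Definition sring_sort (gT : finGroupType) (A : sring gT) : Type :=
  {a : zgroup_ring gT | a \in sring_set A}.
Coercion sring_sort : sring >-> Sortclass.

HB.instance Definition _ (gT : finGroupType) (A : sring gT) :=
  SubChoice.copy (sring_sort A) {a : zgroup_ring gT | a \in sring_set A}.
HB.instance Definition _ (gT : finGroupType) (A : sring gT) :=
  [SubChoice_isSubNzRing of sring_sort A by <:].

Fact set_sum_in_sring (gT : finGroupType) (A : sring gT) (X : {set gT}) :
  X \in basic_sets A -> set_sum X \in sring_set A.
Proof.
move=> AX; apply/sring_span; exists (fun Y => (Y == X)%:R).
rewrite (bigD1 X) //= eqxx big1 ?addr0 // => Y /andP[_ /negPf->].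
by rewrite mulr0z.
Qed.

Definition basic_elt (gT : finGroupType) (A : sring gT) (X : {set gT})
    (AX : X \in basic_sets A) : A :=
  exist _ (set_sum X) (set_sum_in_sring AX).

(* sim_basic is the map X |-> X^phi; only its values on basic_sets A matter. *)
Record similarity (gT gT' : finGroupType) (A : sring gT) (A' : sring gT') :=
  Similarity {
    sim_morph :> {rmorphism A -> A'};
    sim_bij : bijective sim_morph;
    sim_basic : {set gT} -> {set gT'};
    sim_basic_inj : {in basic_sets A &, injective sim_basic};
    sim_basic_im : sim_basic @: basic_sets A = basic_sets A';
    sim_basicE : forall (X : {set gT}) (AX : X \in basic_sets A),
      val (sim_morph (basic_elt AX)) = set_sum (sim_basic X)
  }.

Definition Iso (gT gT' : finGroupType) (A : sring gT) (A' : sring gT')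
    (phi : similarity A A') (f : gT -> gT') : Prop :=
  bijective f /\
  forall (X : {set gT}) (y : gT), X \in basic_sets A ->
    f @: (X :* y)%g = (sim_basic phi X :* f y)%g.

Definition separable_sring (gT : finGroupType) (A : sring gT) : Prop :=
  forall (gT' : finGroupType) (A' : sring gT') (phi : similarity A A'),
    cyclic [set: gT'] -> exists f : gT -> gT', Iso phi f.

(* Main.v *)
Require Import Defs.
From mathcomp Require Import all_boot all_order all_fingroup all_algebra all_solvable.
From mathcomp Require Import zify.

(** A similarity of S-rings is a bijection between basic sets that respects
    structure constants; it is encoded as a relation [R] between the points of
    the two groups (record [schur_rel]), so that every lemma applies at once to
    an S-ring and to a similarity.  A map [f] realises the similarity as soon as
    [R (x * y^-1) (f x * (f y)^-1)] holds for all [x] and [y].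

    Two classical congruences give all the information needed.  For a prime [q]
    not dividing the order, the [q]-th power of a basic set [X], read modulo
    [q], shows that similarities commute with the power maps of exponent
    coprime to [p] (Schur's theorem on multipliers, [schur_expg]): on the basic
    sets that contain generators of a subgroup [<x>], the similarity is thus
    given by any group homomorphism that is correct at [x].  For [q = p] the
    [p]-th power of [X], read modulo [p] after the contribution of the radical
    of [X] has been divided out ([set_sumX_rad]), relates the basic set of [x]
    to that of [x ^ p].

    The basic sets are of two kinds.  Either all elements of [X] generate
    the same subgroup, or [X] is the difference of two subgroups that are unions
    of basic sets ([multilevel_class]).  In the second case the basic set [X]
    imposes nothing on [f] beyond preserving the orders of the quotients
    [x * y^-1] that belong to [X].

    The map [f] is then built along the chain of subgroups
    ([partial_iso_step]).  If it is known on [<x ^ p>] and [y] corresponds to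
    [x], put [f (x ^ (p * a + k)) = f (x ^ (p * a)) * y ^ k] for [k < p].  This
    works if, modulo the radical [L] of the class of [x], the map already
    built is the homomorphism that sends [x ^ p] to [y ^ p].  The congruence
    for [q = p] allows one to choose [y] with [y ^ p] in [f (x ^ p) * L]; and
    the map is linear modulo [L] because the radical of the class of
    [x ^ p] is contained in [L], except when the class of [x] is so large that
    no condition is left, or [p = 2] and the quotient has order 4, where
    linearity is automatic ([extend_choice]).  The inclusion of radicals
    comes from the fact that a multiplier close enough to 1 generates all
    multipliers as close to 1 as itself ([principal_unit_generator]). *)

Set Implicit Arguments.
Unset Strict Implicit.
Unset Printing Implicit Defensive.

(** * Principal units modulo powers of a prime *)

Lemma expn_1D_prime p a : prime p ->
  exists s, (1 + a) ^ p = 1 + p * a + p * a ^ 2 * s + a ^ p.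
Proof.
case: p => [|[|p]] // p_pr; rewrite expnDn.
rewrite big_ord_recl big_ord_recl big_ord_recr /= /bump /=.
exists (\sum_(i < p) 'C(p.+2, i.+2) %/ p.+2 * a ^ i).
rewrite bin0 bin1 binn !exp1n expn0 expn1 !mul1n !addnA; congr (_ + _ + _).
rewrite big_distrr; apply: eq_bigr => i _ /=; rewrite exp1n !mul1n !add1n.
rewrite -[LHS]/('C(p.+2, i.+2) * a ^ (2 + i)) expnD.
have /dvdnP[k ->] : p.+2 %| 'C(p.+2, i.+2) by rewrite prime_dvd_bin //= !ltnS.
by rewrite mulnK // -!mulnA; lia.
Qed.

(** The hypothesis on [p = 2] is what makes [(p ^ e * c) ^ p], the last term
    of the binomial expansion, divisible by [p ^ e.+2]. *)
Lemma expn_lift p e c : prime p -> 0 < e -> (p = 2 -> 1 < e) -> ~~ (p %| c) ->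
  exists2 c', ~~ (p %| c') & (1 + p ^ e * c) ^ p = 1 + p ^ e.+1 * c'.
Proof.
move=> p_pr e0 e2 pc; have [s ->] := expn_1D_prime (p ^ e * c) p_pr.
have p1 := prime_gt1 p_pr.
have [d dE] : exists d, (p ^ e * c) ^ p = p ^ e.+1 * (p * d).
  exists (p ^ (e * p - e.+2) * c ^ p).
  rewrite mulnA -expnSr mulnA -expnD expnMn -expnM; congr (p ^ _ * _).
  have le : e.+2 <= e * p.
    case: (ltngtP p 2) e2 => [p2|p2|->] e2; first by rewrite ltnNge p1 in p2.
      have := leq_mul (leqnn e) p2; clear -e0; lia.
    by have := e2 erefl; clear; lia.
  by clear -le; lia.
exists (c + p * (p ^ e.-1 * c ^ 2 * s + d)); first by rewrite dvdn_addl ?dvdn_mulr.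
rewrite dE expnMn -(prednK e0) /= !expnS; lia.
Qed.

Lemma expn_lift_iter p e c k : prime p -> 0 < e -> (p = 2 -> 1 < e) -> ~~ (p %| c) ->
  exists2 c', ~~ (p %| c') & (1 + p ^ e * c) ^ (p ^ k) = 1 + p ^ (e + k) * c'.
Proof.
move=> p_pr e0 e2 pc; elim: k => [|k [c' pc' IHk]].
  by exists c => //; rewrite expn0 expn1 addn0.
have [|/e2 e1|c'' pc'' E] := @expn_lift p (e + k) c' p_pr _ _ pc'.
- exact: ltn_addr.
- exact: ltn_addr.
by exists c''; rewrite // expnSr expnM IHk addnS.
Qed.

Lemma expn_1D_mod a j m : m %| a ^ 2 -> (1 + a) ^ j = 1 + j * a %[mod m].
Proof.
move=> ma; elim: j => [|j IHj] //.
rewrite expnSr -modnMml IHj modnMml.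
have -> : (1 + j * a) * (1 + a) = j * a ^ 2 + (1 + j.+1 * a) by nia.
by rewrite -modnDml -modnMmr (eqP ma) muln0 mod0n.
Qed.

Lemma solve_mod_prime p a s : prime p -> ~~ (p %| a) -> exists j, j * a = s %[mod p].
Proof.
move=> p_pr pa; have co : coprime a p by rewrite coprime_sym prime_coprime.
exists (s * a ^ (totient p).-1).
rewrite -mulnA -expnSr prednK ?totient_gt0 ?prime_gt0 //.
by rewrite -modnMmr Euler_exp_totient // modnMmr muln1.
Qed.

(** By induction on [N]: the power [p ^ (N - e)] of [1 + p ^ e * c] is 1 modulo
    [p ^ N] but not modulo [p ^ N.+1], so it corrects the last digit.  The case
    [p = 2] and [e = 1] has to be excluded because of -1, which has order 2. *)
Lemma principal_unit_generator p e c N z : prime p -> 0 < e -> (p = 2 -> 1 < e) ->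
  ~~ (p %| c) -> z = 1 %[mod p ^ e] -> exists k, (1 + p ^ e * c) ^ k = z %[mod p ^ N].
Proof.
move=> p_pr e0 e2 pc z1; set w := 1 + _; have p1 := prime_gt1 p_pr.
elim: N => [|N [k wk]]; first by exists 0; rewrite expn0 !modn1.
have [Ne|eN] := ltnP N e.
  exists 0; rewrite expn0.
  by rewrite -(modn_dvdm z (dvdn_exp2l p Ne)) z1 modn_dvdm // dvdn_exp2l.
have [c' pc' E] := expn_lift_iter (N - e) p_pr e0 e2 pc; rewrite -/w subnKC // in E.
have [s sE] : exists s, w ^ k + p ^ N * s = z %[mod p ^ N.+1].
  exists (z %/ p ^ N + (p - 1) * (w ^ k %/ p ^ N)).
  rewrite {1}(divn_eq (w ^ k) (p ^ N)) wk {3}(divn_eq z (p ^ N)).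
  set A := _ %/ _; set B := z %/ _; set C := z %% _.
  have -> : A * p ^ N + C + p ^ N * (B + (p - 1) * A) = A * p ^ N.+1 + (B * p ^ N + C).
    have -> : p ^ N.+1 = (p - 1) * p ^ N + p ^ N
      by rewrite expnS mulnBl mul1n subnK ?leq_pmull ?prime_gt0.
    by move: A B C (p ^ N) (p - 1); clear; lia.
  by rewrite modnMDl.
have pw : ~~ (p %| c' * w ^ k).
  rewrite Euclid_dvdM // negb_or pc' Euclid_dvdX // negb_and.
  by rewrite dvdn_addl ?dvdn_mulr ?dvdn_exp // gtnNdvd.
have [j jE] := solve_mod_prime s p_pr pw.
exists (k + p ^ (N - e) * j); rewrite expnD expnM E -modnMmr.
rewrite expn_1D_mod; last first.
  by rewrite expnMn -expnM dvdn_mulr // dvdn_exp2l //; clear -e0 eN; lia.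
rewrite modnMmr -sE mulnDr muln1 -modnDmr -[in RHS]modnDmr; congr ((_ + _) %% _).
have -> : w ^ k * (j * (p ^ N * c')) = p ^ N * (j * (c' * w ^ k)).
  by rewrite (mulnCA j) mulnCA [w ^ k * _]mulnC -mulnA.
by rewrite expnSr -!muln_modr jE.
Qed.

Lemma odd_mod4 n : odd n -> n %% 4 != 1 -> n %% 4 = 3.
Proof.
rewrite -(@odd_mod n 4) //; have := ltn_pmod n (isT : 0 < 4).
by case: (n %% 4) => [|[|[|[|]]]].
Qed.

Import GroupScope GRing.Theory.

(** * Powers of sums of group elements modulo a prime *)

Section GroupRing.
Local Open Scope ring_scope.
Variable gT : finGroupType.
Implicit Types (a b : zgroup_ring gT) (g h x y : gT) (X : {set gT}) (L : {group gT}).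

Definition zdelta x : zgroup_ring gT := set_sum [set x].

Lemma zdeltaE x y : zdelta x y = (y == x)%:R.
Proof. by rewrite ffunE inE. Qed.

Lemma zgr_mulE a b x : (a * b) x = \sum_h a h * b (h^-1 * x)%g.
Proof. by rewrite ffunE. Qed.

Lemma zgr_addE a b x : (a + b) x = a x + b x.
Proof. by rewrite ffunE. Qed.

Lemma zgr_sumE (I : Type) (r : seq I) (P : pred I) (F : I -> zgroup_ring gT) x :
  (\sum_(i <- r | P i) F i) x = \sum_(i <- r | P i) F i x.
Proof. by apply: (big_morph (fun a : zgroup_ring gT => a x)) => [a b|]; rewrite ffunE. Qed.

Lemma zgr_mulrnE a n x : (a *+ n) x = a x *+ n.
Proof. by elim: n => [|n IHn]; rewrite ?mulr0n ?ffunE // !mulrS ffunE IHn. Qed.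

Lemma zdelta_mulE x b y : (zdelta x * b) y = b (x^-1 * y)%g.
Proof.
rewrite zgr_mulE (bigD1 x) //= big1 => [|h /negPf nhx]; rewrite zdeltaE ?nhx ?mul0r //.
by rewrite eqxx mul1r addr0.
Qed.

Lemma zdeltaM x y : zdelta x * zdelta y = zdelta (x * y)%g.
Proof.
apply/ffunP=> z; rewrite zdelta_mulE !zdeltaE; congr (nat_of_bool _)%:R.
by rewrite -(inj_eq (mulgI x)) mulKVg.
Qed.

Lemma zdeltaX x n : zdelta x ^+ n = zdelta (x ^+ n)%g.
Proof.
elim: n => [|n IHn]; last by rewrite exprS IHn zdeltaM expgS.
by apply/ffunP=> z; rewrite zdeltaE expr0 expg0 ffunE.
Qed.

Lemma set_sumE X : set_sum X = \sum_(x in X) zdelta x.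
Proof.
apply/ffunP=> y; rewrite ffunE zgr_sumE; under eq_bigr do rewrite zdeltaE.
case: (boolP (y \in X)) => yX; last first.
  by rewrite big1 // => x xX; case: eqP => // yx; rewrite yx xX in yX.
rewrite (bigD1 y) //= eqxx big1 ?addr0 // => x /andP[_ /negPf].
by rewrite eq_sym => ->.
Qed.

Lemma set_sum_mulE (X Y : {set gT}) y :
  (set_sum X * set_sum Y) y = #|[set x in X | (x^-1 * y)%g \in Y]|%:R.
Proof.
rewrite zgr_mulE -sum1_card natr_sum big_mkcond [RHS]big_mkcond /=.
apply: eq_bigr => x _; rewrite !ffunE inE.
by case: (x \in X); case: (_ \in Y); rewrite ?mulr0 ?mul0r ?mulr1.
Qed.

End GroupRing.

Section Frobenius.
Local Open Scope ring_scope.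
Variable R : pzRingType.

(** The Frobenius identity, with the error term divisible by [q] kept explicit
    because the ring of interest has characteristic 0. *)
Lemma exprD_prime_comm q (a b : R) : prime q -> GRing.comm a b ->
  exists c, (a + b) ^+ q = a ^+ q + b ^+ q + c *+ q.
Proof.
move=> q_pr cab; case: q q_pr => // q q_pr.
rewrite exprDn_comm // big_ord_recl big_ord_recr /=.
rewrite bin0 subn0 !expr0 mulr1 mulr1n binn subnn expr0 mul1r mulr1n.
exists (\sum_(i < q) (a ^+ (q.+1 - i.+1) * b ^+ i.+1) *+ ('C(q.+1, i.+1) %/ q.+1)).
rewrite -sumrMnl addrAC addrA; congr (_ + _); first congr (_ + _).
by apply: eq_bigr => i _; rewrite -mulrnA divnK // prime_dvd_bin //= ltnS ltn_ord.
Qed.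

Lemma expr_sum_prime_comm q (I : eqType) (r : seq I) (F : I -> R) : prime q ->
  {in r &, forall i j, GRing.comm (F i) (F j)} ->
  exists c, (\sum_(i <- r) F i) ^+ q = \sum_(i <- r) F i ^+ q + c *+ q.
Proof.
move=> q_pr; elim: r => [_|i r IHr cF].
  by exists 0; rewrite !big_nil mul0rn addr0 expr0n gtn_eqF ?prime_gt0.
have [|c Ec] := IHr; first by move=> j k jr kr; apply: cF; rewrite inE ?jr ?kr orbT.
rewrite !big_cons; case: (@exprD_prime_comm q (F i) (\sum_(i <- r) F i)) => //.
  rewrite /GRing.comm mulr_suml mulr_sumr [LHS]big_seq [RHS]big_seq.
  by apply: eq_bigr => j jr; apply: cF; rewrite inE ?eqxx ?jr ?orbT.
by move=> d ->; exists (c + d); rewrite Ec mulrnDl !addrA.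
Qed.

End Frobenius.

Section FrobeniusGroupRing.
Local Open Scope ring_scope.
Variables (gT : finGroupType) (q : nat).
Hypothesis abelG : abelian [set: gT].
Hypothesis q_pr : prime q.
Implicit Types (a b : zgroup_ring gT) (g h x y : gT) (X : {set gT}) (L : {group gT}).

Lemma mulgC_abelian x y : (x * y = y * x)%g.
Proof. by apply: (centsP abelG); rewrite inE. Qed.

Lemma zgr_mulrC a b : a * b = b * a.
Proof.
apply/ffunP=> y; rewrite !zgr_mulE.
rewrite (reindex_inj (h := fun x => (x^-1 * y)%g)) /=; last first.
  by move=> u v /mulIg/invg_inj.
by apply: eq_bigr => x _; rewrite invMg invgK (mulgC_abelian _ x) mulgKV mulrC.
Qed.

Lemma expr_zdelta_sum (I : finType) (P : pred I) (F : I -> gT) :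
  exists c, (\sum_(i | P i) zdelta (F i)) ^+ q =
            \sum_(i | P i) zdelta (F i ^+ q)%g + c *+ q.
Proof.
have [|c] := @expr_sum_prime_comm (zgroup_ring gT) q I (index_enum I)
   (fun i => if P i then zdelta (F i) else 0) q_pr.
  by move=> i j _ _; apply: zgr_mulrC.
rewrite -big_mkcond => ->; exists c; congr (_ + _); rewrite [RHS]big_mkcond.
apply: eq_bigr => i _; case: (P i); first by rewrite zdeltaX.
by rewrite expr0n gtn_eqF ?prime_gt0.
Qed.

Lemma set_sumX_prime X :
  exists c, set_sum X ^+ q = \sum_(x in X) zdelta (x ^+ q)%g + c *+ q.
Proof. by rewrite set_sumE; apply: expr_zdelta_sum. Qed.

Lemma set_sum_groupX L n : set_sum L ^+ n.+1 = set_sum L *+ (#|L| ^ n).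
Proof.
elim: n => [|n IHn]; first by rewrite expr1 mulr1n.
rewrite exprSr IHn mulrnAl expnS [(#|L| * _)%N]mulnC mulrnA mulrnAC.
suff -> : set_sum L * set_sum L = set_sum L *+ #|L| by [].
apply/ffunP=> y; rewrite set_sum_mulE zgr_mulrnE ffunE.
have [yL|yL] := boolP (y \in L).
  congr (_%:R); apply: eq_card => x; rewrite inE; case: (boolP (x \in L)) => //= xL.
  by rewrite groupMl ?groupV.
rewrite mul0rn (_ : [set _ in _ | _] = set0) ?cards0 //.
by apply/setP=> x; rewrite !inE; case: (boolP (x \in L)) => //= xL;
  rewrite groupMl ?groupV ?(negPf yL).
Qed.

(** The [q]-th power of a union [X] of [L]-cosets, read modulo [q]: writing
    [X = T * L] with [T] a transversal, [X ^ q = #|L| ^ q.-1 * (T ^ q * L)],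
    and [T ^ q] is the sum of the [t ^ q] modulo [q].  So, once the common
    factor is removed, the coefficient at [y] counts modulo [q] the cosets of
    [L] in [X] whose [q]-th power is [y * L].  Working with this extra factor
    replaces the passage to the quotient by [L]. *)
Lemma set_sumX_rad X L y : (X * L)%g \subset X ->
  (q * #|L| ^ q.-1 %| `|(set_sum X ^+ q)%R y|)%N =
  (q * #|L| %| #|[set x in X | (x ^+ q)%g \in (y *: L)%g]|)%N.
Proof.
move=> XL; have XLP x u : x \in X -> u \in L -> (u * x)%g \in X.
  by move=> xX uL; rewrite mulgC_abelian (subsetP XL) ?mem_mulg.
pose r x := repr (L :* x); pose T := [set x in X | r x == x].
have rP x : exists2 u, u \in L & r x = (u * x)%g.
  by rewrite /r; case: repr_rcosetP => u uL; exists u.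
have rM x u : u \in L -> r (u * x)%g = r x.
  by move=> uL; rewrite /r rcosetM (rcoset_id uL).
have rT x : x \in X -> r x \in T.
  by move=> xX; case: (rP x) => u uL e; rewrite inE e XLP //= rM // e.
have r_coset t x : t \in T -> ((t^-1 * x)%g \in L) = (r x == t).
  rewrite inE => /andP[tX /eqP rt]; apply/idP/eqP => [txL | <-].
    by rewrite -(mulKVg t x) mulgC_abelian rM.
  case: (rP x) => u uL ->; rewrite mulgC_abelian invMg mulgA mulgV mul1g groupV //.
have EX : set_sum X = set_sum T * set_sum L.
  apply/ffunP=> x; rewrite set_sum_mulE ffunE.
  have -> : [set t in T | (t^-1 * x)%g \in L] = if x \in X then [set r x] else set0.
    apply/setP=> t; rewrite inE; case: (boolP (t \in T)) => tT /=.
      rewrite r_coset //; case: ifP => xX; rewrite inE 1?eq_sym //.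
      apply/eqP=> e; move: tT; rewrite e inE => /andP[]; case: (rP x) => u uL ->.
      by move=> /XLP-/(_ u^-1%g); rewrite groupV mulKg xX => /(_ uL).
    case: ifP => [xX|]; rewrite inE //; apply/esym/eqP => e.
    by rewrite e rT in tT.
  by case: ifP; rewrite ?cards1 ?cards0.
have [c Ec] := set_sumX_prime T.
have L0 := cardG_gt0 L.
pose N := #|[set t in T | (t ^+ q)%g \in (y *: L)%g]|.
have q0 : q.-1.+1 = q by rewrite prednK ?prime_gt0.
have Epow : (set_sum X ^+ q) y = (N%:R + (c * set_sum L) y *+ q) *+ (#|L| ^ q.-1).
  rewrite EX exprMn_comm; last exact: zgr_mulrC.
  rewrite -[in set_sum L ^+ q]q0 set_sum_groupX mulrnAr zgr_mulrnE; congr (_ *+ _).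
  rewrite Ec mulrDl zgr_addE mulrnAl zgr_mulrnE; congr (_ + _).
  rewrite mulr_suml zgr_sumE /N -sum1_card natr_sum big_mkcond [RHS]big_mkcond.
  apply: eq_bigr => t _; rewrite inE; case: (t \in T) => //=.
  rewrite zdelta_mulE ffunE mem_lcoset -groupV invMg invgK.
  by case: (_ \in L).
have -> : #|[set x in X | (x ^+ q)%g \in (y *: L)%g]| = (#|L| * N)%N.
  rewrite -sum1_card (partition_big r (mem T)) /=; last first.
    by move=> x; rewrite inE => /andP[/rT].
  rewrite /N mulnC -sum_nat_const big_mkcond [RHS]big_mkcond.
  apply: eq_bigr => t _; rewrite [in RHS]inE; case: (boolP (t \in T)) => //= tT.
  have tX : t \in X by move: tT; rewrite inE => /andP[].
  have yq u : u \in L -> (((u * t) ^+ q)%g \in (y *: L)%g) = ((t ^+ q)%g \in (y *: L)%g).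
    move=> uL; rewrite !mem_lcoset expgMn; last exact: mulgC_abelian.
    by rewrite mulgC_abelian -mulgA groupMl ?groupX // mulgC_abelian.
  have rt : r t = t by move: tT; rewrite inE => /andP[_ /eqP].
  case: ifP => tq.
    rewrite -[RHS](card_rcoset L t) -sum1_card; apply: eq_bigl => x.
    rewrite !inE mem_rcoset -(r_coset _ _ tT) [(x * _)%g]mulgC_abelian.
    case: (boolP (_ \in L)) => [xL|]; rewrite ?andbF // andbT.
    have -> : x = ((t^-1 * x) * t)%g by rewrite mulgC_abelian mulKVg.
    by rewrite yq // tq XLP.
  rewrite big1 // => x; rewrite inE -(r_coset _ _ tT) => /andP[/andP[_ xq] xL].
  by move: xq; rewrite -(mulKVg t x) mulgC_abelian yq // tq.
rewrite Epow mulnC [(q * _)%N]mulnC dvdn_pmul2l //.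
rewrite -mulr_natl abszM natz absz_nat dvdn_pmul2l ?expn_gt0 ?L0 //.
rewrite -[LHS]/((Posz q) %| _)%Z rpredDr ?natz //.
by rewrite -mulr_natl natz dvdz_mulr.
Qed.

End FrobeniusGroupRing.

(** * Relations between points induced by similarities *)

Section SchurRel.
Variables (gT gT' : finGroupType).
Implicit Types (R : gT -> gT' -> bool).

Definition corr R (a : zgroup_ring gT) (a' : zgroup_ring gT') :=
  forall x y, R x y -> a x = a' y.

Definition corr_set R (V : {set gT}) (V' : {set gT'}) :=
  forall x y, R x y -> (x \in V) = (y \in V').

(** A similarity [phi] of S-rings, seen as a relation between points: [R x y]
    means that [phi] sends the basic set of [x] to the basic set of [y].
    Difunctionality says that [R] is a bijection between the classes of two
    partitions, and [sr_mul] that this bijection respects the structure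
    constants.  The case of an equivalence relation is that of a single
    S-ring; any statement about [R] can thus be applied to the S-rings on
    either side as well as to the similarity itself. *)
Record schur_rel R : Prop := SchurRel {
  sr_totl : forall x, exists y, R x y;
  sr_totr : forall y, exists x, R x y;
  sr_difun : forall x x' y y', R x y -> R x' y -> R x' y' -> R x y';
  sr_1l : forall y, R 1 y -> y = 1;
  sr_1r : forall x, R x 1 -> x = 1;
  sr_mul : forall a b a' b', corr R a a' -> corr R b b' -> corr R (a * b)%R (a' * b')%R
}.

(** The partition of the left-hand group; that of the right-hand group is
    [lrel] of the transposed relation. *)
Definition lrel R : rel gT := fun x x' => [exists y, R x y && R x' y].

End SchurRel.

Lemma schur_rel_sym (gT gT' : finGroupType) (R : gT -> gT' -> bool) :
  schur_rel R -> schur_rel (fun y x => R x y).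
Proof.
case=> tl tr df l1 r1 mu; split=> // [x x' y y' xy x'y x'y'|a b a' b' aa bb x y xy].
  exact: df x'y' x'y xy.
by apply/esym/(mu a' b' a b) => // u v uv; apply/esym; [apply: aa | apply: bb].
Qed.

Section SchurRelTheory.
Variables (gT gT' : finGroupType) (R : gT -> gT' -> bool).
Hypothesis SR : schur_rel R.

Lemma sr11 : R 1 1.
Proof. by have [y Ry] := sr_totl SR 1; have y1 := sr_1l SR Ry; rewrite y1 in Ry. Qed.

Lemma corr_set_sum V V' : corr_set R V V' -> corr R (set_sum V) (set_sum V').
Proof. by move=> c x y /c e; rewrite !ffunE e. Qed.

Lemma corr_expr a a' n : corr R a a' -> corr R (a ^+ n)%R (a' ^+ n)%R.
Proof.
move=> c; elim: n => [|n IHn] x y xy; last by rewrite !exprS (sr_mul SR c IHn xy).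
rewrite !expr0 !ffunE; congr (nat_of_bool _)%:R%R.
by apply/eqP/eqP => e; move: xy; rewrite e; [move/(sr_1l SR) | move/(sr_1r SR)].
Qed.

Lemma corr_setT : corr_set R setT setT.
Proof. by move=> x y _; rewrite !inE. Qed.

(** Compare the coefficients at 1 in the products with the whole group. *)
Lemma corr_set_card V V' : corr_set R V V' -> #|V| = #|V'|.
Proof.
move=> c; have := sr_mul SR (corr_set_sum c) (corr_set_sum corr_setT) sr11.
rewrite !set_sum_mulE => /eqP; rewrite !natz => /eqP[].
have setE (T : finGroupType) (U : {set T}) : [set x in U | x^-1 * 1 \in [set: T]] = U.
  by apply/setP=> x; rewrite !inE andbT.
by rewrite !setE.
Qed.

Lemma card_schur_rel : #|gT| = #|gT'|.
Proof. by have := corr_set_card corr_setT; rewrite !cardsT. Qed.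

Lemma corr_setM V V' W W' :
  corr_set R V V' -> corr_set R W W' -> corr_set R (V * W) (V' * W').
Proof.
move=> cV cW x y xy; have := sr_mul SR (corr_set_sum cV) (corr_set_sum cW) xy.
rewrite !set_sum_mulE !natz => -[] e.
have E (T : finGroupType) (A B : {set T}) z :
    (z \in A * B) = (0 < #|[set t in A | t^-1 * z \in B]|).
  apply/mulsgP/card_gt0P => [[a b aA bB ->] | [a]].
    by exists a; rewrite inE aA mulKg.
  by rewrite inE => /andP[aA aB]; exists a (a^-1 * z); rewrite ?mulKVg.
by rewrite !E e.
Qed.

Lemma corr_setU V V' W W' :
  corr_set R V V' -> corr_set R W W' -> corr_set R (V :|: W) (V' :|: W').
Proof. by move=> cV cW x y xy; rewrite !inE (cV _ _ xy) (cW _ _ xy). Qed.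

Lemma corr_setD V V' W W' :
  corr_set R V V' -> corr_set R W W' -> corr_set R (V :\: W) (V' :\: W').
Proof. by move=> cV cW x y xy; rewrite !inE (cV _ _ xy) (cW _ _ xy). Qed.

Lemma corr_set1 : corr_set R 1 1.
Proof.
move=> x y xy; rewrite !inE.
by apply/eqP/eqP => e; move: xy; rewrite e; [move/(sr_1l SR) | move/(sr_1r SR)].
Qed.

Lemma corr_setX V V' n : corr_set R V V' -> corr_set R (V ^+ n) (V' ^+ n).
Proof.
by move=> c; elim: n => [|n IHn]; [exact: corr_set1 | rewrite !expgS; apply: corr_setM].
Qed.

Lemma gen_expgs_mul (T : finGroupType) (V : {set T}) n m : 0 < m ->
  <<V>> = (1 |: V) ^+ n -> <<V>> = (1 |: V) ^+ (n * m).
Proof.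
move=> m0 e; rewrite expgM -e; case: m m0 => // m _.
by elim: m => [|m IHm]; rewrite ?expg1 // expgS -IHm mulGid.
Qed.

(** The subgroup generated by [V] is a power of [1 |: V]; a common exponent
    serves both sides. *)
Lemma corr_set_gen V V' : corr_set R V V' -> corr_set R <<V>> <<V'>>.
Proof.
move=> c; have [n e] := gen_expgs V; have [n' e'] := gen_expgs V'.
rewrite (gen_expgs_mul (ltn0Sn n') (n := n.+1)); last first.
  by rewrite expgS -e mulUg mul1g; apply/esym/setUidPl; rewrite mul_subG // subset_gen.
rewrite [X in corr_set _ _ X](gen_expgs_mul (ltn0Sn n) (n := n'.+1)); last first.
  by rewrite expgS -e' mulUg mul1g; apply/esym/setUidPl; rewrite mul_subG // subset_gen.
rewrite [(n'.+1 * _)%N]mulnC; apply: corr_setX; apply: corr_setU => //.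
exact: corr_set1.
Qed.

Lemma corr_set_uniq V V' W' : corr_set R V V' -> corr_set R V W' -> V' = W'.
Proof.
move=> c c'; apply/setP=> y; have [x xy] := sr_totr SR y.
by rewrite -(c _ _ xy) (c' _ _ xy).
Qed.

Lemma corr_class x y : R x y -> corr_set R [set x' | R x' y] [set y' | R x y'].
Proof.
move=> xy u v uv; rewrite !inE; apply/idP/idP => h.
  exact: (sr_difun SR xy h uv).
exact: (sr_difun SR uv h xy).
Qed.

Lemma lrelE x x' y : R x y -> lrel R x x' = R x' y.
Proof.
move=> xy; apply/existsP/idP => [[v /andP[xv x'v]] | x'y].
  exact: (sr_difun SR x'v xv xy).
by exists y; rewrite xy.
Qed.

Lemma lrel_refl : reflexive (lrel R).
Proof. by move=> x; have [y xy] := sr_totl SR x; rewrite (lrelE _ xy). Qed.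

Lemma schur_lrel : schur_rel (lrel R).
Proof.
have LE := lrelE; have Lsym x x' : lrel R x x' = lrel R x' x.
  by apply: eq_existsb => y; rewrite andbC.
split.
- by move=> x; exists x; apply: lrel_refl.
- by move=> x; exists x; apply: lrel_refl.
- move=> x x' u u'; have [y xy] := sr_totl SR x; rewrite !(LE _ _ _ xy).
  move=> uy; rewrite Lsym (LE _ _ _ uy) => x'y; by rewrite (LE _ _ _ x'y).
- by move=> x; rewrite (LE _ _ _ sr11) => /(sr_1r SR).
- by move=> x; rewrite Lsym (LE _ _ _ sr11) => /(sr_1r SR).
(* An element of the left-hand S-ring has a counterpart on the right, which
   carries the multiplicativity of [R] over to [lrel R]. *)
have lift a a' : corr (lrel R) a a' -> exists2 b, corr R a b & corr R a' b.
  move=> c; have aa x : a x = a' x by apply/c/lrel_refl.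
  pose r y := odflt 1 [pick x | R x y].
  have E x y : R x y -> a x = a (r y).
    rewrite /r; case: pickP => [x' x'y xy /=|/(_ x)/negbT/negP//].
    by rewrite [RHS]aa; apply: c; rewrite (LE _ _ _ xy).
  exists [ffun y => a (r y)] => x y xy; rewrite ?ffunE -?aa; exact: E.
move=> a b a' b' /lift[c ac a'c] /lift[d bd b'd] x x' /existsP[y /andP[xy x'y]].
by rewrite (sr_mul SR ac bd xy) (sr_mul SR a'c b'd x'y).
Qed.

End SchurRelTheory.

(** * Multipliers and radicals *)

Lemma coprime_expg_inj (gT : finGroupType) (w : nat) : abelian [set: gT] ->
  coprime w #|gT| -> injective (fun x : gT => x ^+ w).
Proof.
move=> abG co x y e; have co' : coprime #|[set: gT]| w by rewrite cardsT coprime_sym.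
by rewrite -(expgK co' (in_setT x)) -(expgK co' (in_setT y)) /= e.
Qed.

Lemma prime_power_coef (gT : finGroupType) (q : nat) (X : {set gT}) (y : gT) :
  abelian [set: gT] -> prime q -> coprime q #|gT| ->
  (q %| `|(set_sum X ^+ q)%R y|)%N = (y \notin [set x ^+ q | x in X]).
Proof.
move=> abG q_pr co; have := @set_sumX_rad gT q abG q_pr X 1%G y.
rewrite mulg1 => /(_ (subxx _)); rewrite cards1 exp1n !muln1 => ->.
have inj := coprime_expg_inj abG co.
set A := [set _ in _ | _].
have [yX|yX] := boolP (y \in _).
  case/imsetP: yX => x xX yE; rewrite (_ : A = [set x]) ?cards1 ?dvdn1.
    by rewrite gtn_eqF ?prime_gt1.
  apply/setP=> z; rewrite !inE mem_lcoset inE -eq_invg_mul invgK yE eq_sym (inj_eq inj).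
  by case: eqP => [->|]; rewrite ?xX ?andbF.
rewrite (_ : A = set0) ?cards0 ?dvdn0 //.
apply/setP=> z; rewrite !inE mem_lcoset inE -eq_invg_mul invgK.
by apply: contraNF yX => /andP[zX /eqP->]; apply: imset_f.
Qed.

Section Multipliers.

(** Schur's theorem on multipliers for a prime [q] not dividing the order:
    modulo [q], the [q]-th power of the class of [x] is the set of its
    [q]-th powers, which is therefore a union of classes.  So the class of
    [x ^ q] is contained in the image of the class of [x] under the [q]-th
    power map, and comparing the sizes along the orbit of [x] under this map
    forces equality. *)
Lemma lrel_expg_prime (gT : finGroupType) (E : rel gT) (q : nat) x y :
    abelian [set: gT] -> schur_rel E -> reflexive E -> prime q -> coprime q #|gT| ->
  E x y -> E (x ^+ q) (y ^+ q).
Proof.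
move=> abG SE Er q_pr co.
pose C x := [set x' | E x x'].
have Cself z : z \in C z by rewrite inE.
have CE z : corr_set E (C z) (C z).
  move=> u v uv; rewrite !inE; apply/idP/idP => h; first exact: (sr_difun SE h (Er u) uv).
  by apply: (sr_difun SE h uv); apply: Er.
have sub z : C (z ^+ q) \subset [set u ^+ q | u in C z].
  apply/subsetP=> v; rewrite inE => zv.
  have e := corr_expr SE q (corr_set_sum (CE z)) zv.
  apply: contraTT (imset_f (fun u => u ^+ q) (Cself z)).
  by rewrite -!prime_power_coef // e.
have le z : #|C (z ^+ q)| <= #|C z|.
  exact: leq_trans (subset_leq_card (sub z)) (leq_imset_card _ _).
have leX z n : #|C (z ^+ (q ^ n))| <= #|C z|.
  elim: n => [|n IHn]; first by rewrite expn0 expg1.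
  by rewrite expnSr expgM; apply: leq_trans (le _) IHn.
have qq (z : gT) : z ^+ (q ^ totient #|gT|) = z.
  have := Euler_exp_totient co; move/eqP; rewrite eqn_mod_dvd => [/dvdnP[k ek]|]; last first.
    by rewrite expn_gt0 prime_gt0.
  have -> : (q ^ totient #|gT| = (#|gT| * k).+1)%N.
    by rewrite mulnC -ek subn1 prednK // expn_gt0 prime_gt0.
  by rewrite expgS expgM -cardsT expg_cardG ?inE // expg1n mulg1.
have eqC z : C (z ^+ q) = [set u ^+ q | u in C z].
  apply/eqP; rewrite eqEcard sub /=; apply: leq_trans (leq_imset_card _ _) _.
  rewrite -{1}(qq z) -(prednK (n := totient _)); last first.
    by rewrite totient_gt0 -cardsT cardG_gt0.
  by rewrite expnS expgM.
move=> xy; suff : y ^+ q \in C (x ^+ q) by rewrite inE.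
by rewrite eqC; apply: (imset_f (fun u => u ^+ q)); rewrite inE.
Qed.

Variables (gT gT' : finGroupType) (R : gT -> gT' -> bool).
Hypotheses (SR : schur_rel R) (abG : abelian [set: gT]) (abG' : abelian [set: gT']).

(** By the same congruence modulo a prime [q], the class of [x ^ q] corresponds
    to the class of the [q]-th power of some element related to [x]; by the
    previous lemma all these powers lie in one class. *)
Lemma schur_expg w x y : coprime w #|gT| -> R x y -> R (x ^+ w) (y ^+ w).
Proof.
elim/ltn_ind: w x y => w IHw x y co xy.
have [w1|w1] := leqP w 1.
  case: w w1 co {IHw} => [_|[|w]] // co.
    by rewrite !expg0; apply: sr11.
have [q q_pr [k wE]] : exists2 q, prime q & exists k, w = (k * q)%N.
  by exists (pdiv w); [exact: pdiv_prime | exists (w %/ pdiv w); rewrite divnK ?pdiv_dvd].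
rewrite {}wE in IHw co w1 *; move: co; rewrite coprimeMl => /andP[cok coq].
have : R (x ^+ k) (y ^+ k).
  apply: IHw => //; rewrite -{1}[k]muln1 ltn_pmul2l ?prime_gt1 //.
  by case: (k) w1.
rewrite !expgM; move: (x ^+ k) (y ^+ k) => {xy}x {}y xy.
have [v xqv] := sr_totl SR (x ^+ q).
have := corr_expr SR q (corr_set_sum (corr_class SR xy)) xqv => e.
have: x ^+ q \in [set u ^+ q | u in [set x' | R x' y]].
  by apply: (imset_f (fun u => u ^+ q)); rewrite inE.
rewrite -[_ \in _]negbK -prime_power_coef // e prime_power_coef ?negbK; last 3 first.
- by [].
- by [].
- by rewrite -(card_schur_rel SR).
case/imsetP=> y'; rewrite inE => xy' vE.
have SR' := schur_rel_sym SR.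
have: lrel (fun y x => R x y) (y' ^+ q) (y ^+ q).
  apply: lrel_expg_prime => //; last by apply/existsP; exists x; rewrite xy xy'.
  - exact: schur_lrel.
  - exact: lrel_refl.
  - by rewrite -(card_schur_rel SR).
by rewrite (lrelE SR' _ (y := x ^+ q)) -?vE.
Qed.

Lemma schur_inv x y : R x y -> R x^-1 y^-1.
Proof.
have inv (T : finGroupType) (z : T) : z^-1 = z ^+ #|T|.-1.
  rewrite -cardsT -[z^-1]mulg1 -(expg_cardG (in_setT z)).
  by rewrite -{1}(prednK (cardG_gt0 [set: T])) expgS mulKg.
rewrite !inv (card_schur_rel SR) => xy; apply: schur_expg => //.
have := cardG_gt0 [set: gT']; rewrite cardsT (card_schur_rel SR).
by case: #|gT'| => // n _ /=; apply: coprimenS.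
Qed.

End Multipliers.

Section Radical.

(** The radical: the largest subgroup of which [X] is a union of cosets. *)
Definition set_rad (gT : finGroupType) (X : {set gT}) : {set gT} := 'N(X | 'R).

Canonical set_rad_group (gT : finGroupType) (X : {set gT}) := [group of set_rad X].

Lemma set_radP (gT : finGroupType) (X : {set gT}) u :
  reflect (forall x, x \in X -> x * u \in X) (u \in set_rad X).
Proof.
apply: (iffP idP) => [uX x xX | uX]; first by have := astabs_act x uX; rewrite /= xX.
by rewrite /set_rad !inE; apply/subsetP=> x xX; rewrite inE; apply: uX.
Qed.

Lemma mul_rad (gT : finGroupType) (X : {set gT}) : X * set_rad X \subset X.
Proof. by apply/subsetP=> _ /mulsgP[x u xX /set_radP uX ->]; apply: uX. Qed.

Variables (gT gT' : finGroupType) (R : gT -> gT' -> bool).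
Hypotheses (SR : schur_rel R) (abG : abelian [set: gT]) (abG' : abelian [set: gT']).

Lemma corr_set_inv V V' : corr_set R V V' -> corr_set R V^-1 V'^-1.
Proof. by move=> c x y xy; rewrite !inE; apply/c/schur_inv. Qed.

(** The radical is the set of points at which [X^-1 * X] has the coefficient
    [#|X|]. *)
Lemma corr_set_rad V V' : corr_set R V V' -> corr_set R (set_rad V) (set_rad V').
Proof.
move=> c x y xy; have cc := sr_mul SR (corr_set_sum (corr_set_inv c)) (corr_set_sum c) xy.
have radE (T : finGroupType) (U : {set T}) u :
    (u \in set_rad U) = ((set_sum U^-1%g * set_sum U)%R u == #|U|%:R%R).
  rewrite set_sum_mulE !natz eqz_nat -(card_invg U).
  have subU : [set x in U^-1 | x^-1 * u \in U] \subset U^-1.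
    by apply/subsetP=> z; rewrite inE => /andP[].
  apply/set_radP/eqP => [uU|eqU z zU].
    apply: eq_card => z; rewrite !inE; case: (boolP (_ \in U)) => //= zU; exact: uU.
  have /eqP/setP/(_ z^-1) : [set x in U^-1 | x^-1 * u \in U] == U^-1.
    by rewrite eqEcard subU eqU /=.
  by rewrite !inE invgK zU.
by rewrite !radE cc (corr_set_card SR c).
Qed.

End Radical.

(** * Levels in a cyclic p-group *)

Section CyclicPGroup.
Variables (p : nat) (gT : finGroupType).
Hypotheses (p_pr : prime p) (cycG : cyclic [set: gT]) (pG : p.-group [set: gT]).
Implicit Types (x y u v : gT) (H K : {group gT}).

(** The level: subgroups form a chain, and the level of [x] is the place in
    this chain of the subgroup that [x] generates. *)
Definition lv x := logn p #[x].

Lemma abelG : abelian [set: gT]. Proof. exact: cyclic_abelian. Qed.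

Lemma mulgCa x y : x * y = y * x.
Proof. exact: (mulgC_abelian abelG). Qed.

Lemma expgMa x y n : (x * y) ^+ n = x ^+ n * y ^+ n.
Proof. by apply: expgMn; apply: mulgCa. Qed.

Lemma order_lv x : #[x] = (p ^ lv x)%N.
Proof. rewrite /lv -p_part part_pnat_id //; exact: mem_p_elt pG (in_setT x). Qed.

Lemma mem_Ohm i x : (x \in 'Ohm_i([set: gT])) = (lv x <= i).
Proof.
rewrite (OhmEabelian pG) ?(abelianS (Ohm_sub _ _)) ?abelG // !inE /=.
by rewrite -order_dvdn order_lv dvdn_Pexp2l ?prime_gt1.
Qed.

Lemma lv1 : lv 1 = 0. Proof. by rewrite /lv order1 logn1. Qed.

Lemma lv_eq0 x : (lv x == 0) = (x == 1).
Proof. by rewrite -order_eq1 order_lv -(expn0 p) eqn_exp2l ?prime_gt1. Qed.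

Lemma lvV x : lv x^-1 = lv x. Proof. by rewrite /lv orderV. Qed.

Lemma lvX_le x a k : (lv (x ^+ a) <= k) = (p ^ (lv x - k) %| a).
Proof.
rewrite -mem_Ohm (OhmEabelian pG) ?(abelianS (Ohm_sub _ _)) ?abelG // !inE /=.
rewrite -expgM -order_dvdn order_lv.
have [xk|kx] := leqP (lv x) k.
  by rewrite dvdn_mull ?dvdn_exp2l // (eqP (_ : lv x - k == 0)) ?subn_eq0 // dvd1n.
by rewrite -{1}(subnK (ltnW kx)) expnD dvdn_pmul2r ?expn_gt0 ?prime_gt0.
Qed.

Lemma lvX x a : lv (x ^+ a) <= lv x.
Proof. by rewrite lvX_le subnn dvd1n. Qed.

Lemma lvX_coprime x w : coprime p w -> lv (x ^+ w) = lv x.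
Proof.
move=> co; rewrite /lv orderXgcd order_lv.
by rewrite (eqP (_ : coprime _ _)) ?divn1 // coprimeXl.
Qed.

Lemma lvXp x k : lv (x ^+ (p ^ k)) = lv x - k.
Proof.
have E i : (lv (x ^+ (p ^ k)) <= i) = (lv x - i <= k).
  by rewrite lvX_le dvdn_Pexp2l ?prime_gt1.
have := E (lv x - k); have := E (lv (x ^+ (p ^ k))); lia.
Qed.

Lemma lvXprime x : lv (x ^+ p) = (lv x).-1.
Proof. by rewrite -[X in x ^+ X]expn1 lvXp subn1. Qed.

Lemma mem_cycle_lv x y : (x \in <[y]>) = (lv x <= lv y).
Proof.
rewrite -cycle_subG -(cardSg_cyclic cycG) ?subsetT // -[#|_|]/(#[x]) -[#|<[y]>|]/(#[y]).
by rewrite !order_lv dvdn_Pexp2l ?prime_gt1.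
Qed.

Lemma Ohm_lv y : 'Ohm_(lv y)([set: gT]) = <[y]>.
Proof. by apply/setP=> x; rewrite mem_Ohm mem_cycle_lv. Qed.

Lemma card_Ohm_lv y : #|'Ohm_(lv y)([set: gT])| = (p ^ lv y)%N.
Proof. by rewrite Ohm_lv -order_lv. Qed.

Lemma subgroup_lv H : exists y, H = 'Ohm_(lv y)([set: gT]) :> {set gT}.
Proof.
have /cyclicP[y Hy] : cyclic H := cyclicS (subsetT H) cycG.
by exists y; rewrite Ohm_lv.
Qed.

Lemma mem_lv_le H x y : y \in H -> lv x <= lv y -> x \in H.
Proof. by rewrite -mem_cycle_lv -cycle_subG => /subsetP; apply. Qed.

Lemma exp_exists x y : lv x <= lv y -> exists w, x = y ^+ w.
Proof. by rewrite -mem_cycle_lv => /cycleP. Qed.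

Lemma exp_exists_coprime x y : lv x = lv y -> exists2 w, coprime p w & x = y ^+ w.
Proof.
move=> xy; have [y1|y1] := eqVneq (lv y) 0.
  exists 1%N; first by rewrite coprimen1.
  move: y1 (y1); rewrite -{1}xy => /eqP + /eqP.
  by rewrite !lv_eq0 => /eqP-> /eqP->; rewrite expg1n.
have [|w xE] := @exp_exists x y; first by rewrite xy.
exists w => //; rewrite prime_coprime //; apply/negP => pw.
have : lv (y ^+ w) <= (lv y).-1.
  by rewrite lvX_le (_ : lv y - (lv y).-1 = 1%N) ?expn1 //; lia.
by rewrite -xE xy; lia.
Qed.

Lemma lvM_le x y k : lv x <= k -> lv y <= k -> lv (x * y) <= k.
Proof. by rewrite -!mem_Ohm; apply: groupM. Qed.

Lemma lvM_lt x u : lv u < lv x -> lv (x * u) = lv x.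
Proof.
move=> ux; apply/eqP; rewrite eqn_leq lvM_le ?leqnn ?(ltnW ux) //=.
case: leqP => // xux.
have : lv (x * u * u^-1) <= (lv x).-1 by apply: lvM_le; rewrite ?lvV; lia.
by rewrite mulgK; lia.
Qed.

Lemma lv_ratio x w n k : (lv (x ^+ w * (x ^+ n)^-1) <= k) = (w == n %[mod p ^ (lv x - k)]).
Proof.
wlog nw : w n / n <= w.
  move=> W; have [|/ltnW] := leqP n w; first exact: W.
  by move=> /W; rewrite eq_sym => <-; rewrite -[in RHS]lvV invMg invgK.
by rewrite -expgnFr // eqn_mod_dvd // lvX_le.
Qed.

Lemma exists_lv i : i <= logn p #|gT| -> exists y, lv y = i.
Proof.
have /cyclicP[g Eg] := cycG.
have lg : lv g = logn p #|gT| by rewrite /lv /order -Eg cardsT.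
by move=> ig; exists (g ^+ (p ^ (lv g - i))); rewrite lvXp; lia.
Qed.

Lemma lv_le_logn x : lv x <= logn p #|gT|.
Proof. by rewrite /lv dvdn_leq_log // -cardsT ?cardG_gt0 // order_dvdG ?inE. Qed.

Lemma card_Ohm i x : i <= lv x -> #|'Ohm_i([set: gT])| = (p ^ i)%N.
Proof.
move=> ix; have [|y <-] := @exists_lv i; last exact: card_Ohm_lv.
exact: leq_trans ix (lv_le_logn _).
Qed.

Lemma card_expn : #|gT| = (p ^ logn p #|gT|)%N.
Proof. by rewrite -cardsT -p_part part_pnat_id. Qed.

Lemma coprime_card w : coprime p w -> coprime w #|gT|.
Proof. by move=> co; rewrite card_expn coprime_sym coprimeXl. Qed.

End CyclicPGroup.

(** * The p-th power of a set modulo its radical *)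

Lemma dvdn_card_mul_closed (gT : finGroupType) (K : {group gT}) (S : {set gT}) :
  S * K \subset S -> #|K| %| #|S|.
Proof.
move=> SK; have P := preim_partitionP (fun x => x *: K) S.
rewrite (card_uniform_partition (n := #|K|) _ P) ?dvdn_mull // => B.
case/imsetP=> x xS ->; rewrite -(card_lcoset K x); apply: eq_card => y.
rewrite !inE; apply/andP/idP => [[_ /eqP->]|yxK]; first exact: lcoset_refl.
split; last by rewrite (lcoset_eqP yxK).
by apply: (subsetP SK); case/lcosetP: yxK => u uK ->; apply: mem_mulg.
Qed.

Section PowerSet.
Variables (p : nat) (gT : finGroupType).
Hypotheses (p_pr : prime p) (cycG : cyclic [set: gT]) (pG : p.-group [set: gT]).
Implicit Types (X : {set gT}) (x y z u : gT).

(** The elements [x ^ p * u] with [x] in [X] and [u] in the radical of [X], but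
    only those that the [p]-th power of [X] detects modulo [p]: as shown
    below, those for which the coset of [x] by the subgroup one level above the
    radical is not contained in [X]. *)
Definition pth_power_support X :=
  [set y | ~~ (p * #|set_rad X| ^ p.-1 %| `|(set_sum X ^+ p)%R y|)%N].

Lemma mem_pth_power_supportE X y :
  (y \in pth_power_support X) =
  ~~ (p * #|set_rad X| %| #|[set x in X | x ^+ p \in y *: set_rad X]|)%N.
Proof. by rewrite inE (set_sumX_rad (abelG cycG)) // mul_rad. Qed.

Lemma pth_power_support_ex X y : y \in pth_power_support X ->
  exists x u, [/\ x \in X, u \in set_rad X & y = x ^+ p * u].
Proof.
rewrite mem_pth_power_supportE;
have [->|[x]] := set_0Vmem [set x in X | x ^+ p \in y *: set_rad X].
  by rewrite cards0 dvdn0.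
rewrite inE => /andP[xX /lcosetP[u uX E]] _; exists x, u^-1.
by rewrite groupV E mulgK.
Qed.

(** The elements of [X] with [p]-th power in [x ^ p * set_rad X] are those of [X] in
    the coset of [x] by [Ohm_r.+1]; their number is a positive multiple of
    [p ^ r], at most [p ^ r.+1]. *)
Lemma mem_pth_power_support X r x u :
    set_rad X = 'Ohm_r([set: gT]) -> r < lv p x -> x \in X -> u \in set_rad X ->
  (x ^+ p * u \in pth_power_support X) = ~~ (x *: 'Ohm_r.+1([set: gT]) \subset X).
Proof.
move=> radX rx xX uX; rewrite mem_pth_power_supportE; congr (~~ _).
have card i := card_Ohm p_pr cycG pG (i := i) (x := x).
have p_gt0 := prime_gt0 p_pr.
have -> : [set y in X | y ^+ p \in (x ^+ p * u) *: set_rad X] = X :&: x *: 'Ohm_r.+1([set: gT]).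
  apply/setP=> y; rewrite !inE; case: (y \in X) => //=.
  rewrite lcosetM (lcoset_id uX) /= radX !mem_lcoset !(mem_Ohm p_pr cycG pG).
  by rewrite -expgVn -(expgMa cycG) -[X in _ ^+ X]expn1 lvXp // leq_subLR add1n.
rewrite radX (card r) 1?ltnW // -expnS -(card r.+1) //.
apply/idP/idP => [/dvdn_leq le | sub]; last by rewrite (setIidPr sub) card_lcoset.
apply/setIidPr/eqP; rewrite eqEcard subsetIr card_lcoset le //.
by apply/card_gt0P; exists x; rewrite inE xX lcoset_refl.
Qed.

End PowerSet.

Lemma corr_pth_power_support (p : nat) (gT gT' : finGroupType) (R : gT -> gT' -> bool) X X' :
  abelian [set: gT] -> abelian [set: gT'] -> schur_rel R ->
  corr_set R X X' -> corr_set R (pth_power_support p X) (pth_power_support p X').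
Proof.
move=> abG abG' SR c x y xy; rewrite !inE.
rewrite (corr_set_card SR (corr_set_rad SR abG abG' c)).
by rewrite (corr_expr SR p (corr_set_sum c) xy).
Qed.

(** * Basic sets of an S-ring over a cyclic p-group *)

Section SchurPartition.
Variables (p : nat) (gT : finGroupType).
Hypotheses (p_pr : prime p) (cycG : cyclic [set: gT]) (pG : p.-group [set: gT]).
Variable E : rel gT.
Hypotheses (SE : schur_rel E) (Er : reflexive E).
Implicit Types (V : {set gT}) (x y z h u v : gT).

Local Notation T i := 'Ohm_i([set: gT]).
Local Notation lv := (@lv p gT).
Local Notation inv V := (corr_set E V V).

Definition cls x := [set x' | E x x'].

Let abG : abelian [set: gT]. Proof. exact: abelG. Qed.
Let memT i x : (x \in T i) = (lv x <= i). Proof. exact: mem_Ohm. Qed.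

Lemma Esym x y : E x y = E y x.
Proof. by apply/idP/idP => h; apply: (sr_difun SE (Er _) h (Er _)). Qed.

Lemma Etrans x y z : E x y -> E y z -> E x z.
Proof. by move=> xy yz; apply: (sr_difun SE xy (Er y) yz). Qed.

Lemma inv_cls x : inv (cls x).
Proof.
move=> u v uv; rewrite !inE; apply/idP/idP => h; first exact: Etrans uv.
by apply: Etrans h _; rewrite Esym.
Qed.

Lemma inv_mem V x y : inv V -> E x y -> x \in V -> y \in V.
Proof. by move=> iV /iV ->. Qed.

Lemma inv_T0 : inv (T 0).
Proof. by rewrite Ohm0; apply: corr_set1. Qed.

Lemma Eexp w x y : coprime p w -> E x y -> E (x ^+ w) (y ^+ w).
Proof. by move=> co; apply: (schur_expg SE abG abG (coprime_card pG co)). Qed.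

Lemma expg_eqmod w n x : w = n %[mod p ^ lv x] -> x ^+ w = x ^+ n.
Proof. by move=> e; rewrite -(expg_mod_order x w) -(expg_mod_order x n) (order_lv pG) e. Qed.

Lemma gen_lv_max V z : z \in V -> (forall x, x \in V -> lv x <= lv z) -> <<V>> = T (lv z).
Proof.
move=> zV max; apply/eqP; rewrite eqEsubset gen_subG; apply/andP; split.
  by apply/subsetP=> x /max; rewrite memT.
by rewrite Ohm_lv // cycle_subG mem_gen.
Qed.

Lemma inv_T_max V z :
  inv V -> z \in V -> (forall x, x \in V -> lv x <= lv z) -> inv (T (lv z)).
Proof. by move=> iV zV max; rewrite -(gen_lv_max zV max); apply: corr_set_gen. Qed.

Lemma cls_max x : exists2 y, E x y & forall v, E x v -> lv v <= lv y.
Proof.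
have := @arg_maxnP _ x (E x) lv (Er x); case=> y xy max.
by exists y => // v /max.
Qed.

Lemma stab_cls w x y : coprime p w -> E x y -> E x (x ^+ w) -> E y (y ^+ w).
Proof.
move=> co xy xw; apply: (Etrans _ (Eexp co xy)); apply: Etrans xw.
by rewrite Esym.
Qed.

Lemma stab_pow w x k : coprime p w -> E x (x ^+ w) -> E x (x ^+ (w ^ k)).
Proof.
move=> co xw; elim: k => [|k IHk]; first by rewrite expn0 expg1.
by rewrite expnSr expgM; apply: Etrans xw (Eexp co IHk).
Qed.

(** The multipliers that are 1 modulo [p ^ e] preserve the class of [x].  For
    [e = 0] these are all multipliers. *)
Definition fixes x e := forall w, coprime p w -> w = 1 %[mod p ^ e] -> E x (x ^+ w).

Lemma fixes_cls x y e : E x y -> fixes x e -> fixes y e.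
Proof. by move=> xy fx w co w1; apply: stab_cls xy (fx w co w1). Qed.

Lemma fixes_lv x : fixes x (lv x).
Proof. by move=> w _ w1; rewrite (expg_eqmod w1) expg1. Qed.

Lemma coprime_mod1 w e : 0 < e -> w = 1 %[mod p ^ e] -> coprime p w.
Proof.
move=> e0 w1; have: coprime (p ^ e) w by rewrite -coprime_modr w1 coprime_modr coprimen1.
by rewrite coprime_pexpl.
Qed.

Lemma fixes_gen x e w : 0 < e -> (p = 2 -> 1 < e) ->
  w = 1 %[mod p ^ e] -> w != 1 %[mod p ^ e.+1] -> E x (x ^+ w) -> fixes x e.
Proof.
move=> e0 e2 w1 nw1 xw v co v1; have p1 := prime_gt1 p_pr.
have pe1 : 1 < p ^ e by rewrite -(expn0 p) ltn_exp2l.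
have wE : w = 1 + p ^ e * (w %/ p ^ e).
  by rewrite {1}(divn_eq w (p ^ e)) w1 modn_small // addnC mulnC.
have pc : ~~ (p %| w %/ p ^ e).
  apply: contraNN nw1 => /dvdnP[c cE]; rewrite wE cE.
  by rewrite (mulnC c) mulnA -expnSr mulnC addnC modnMDl.
have [k kv] := principal_unit_generator (lv x) p_pr e0 e2 pc v1.
rewrite -wE in kv; rewrite -(expg_eqmod kv); apply: stab_pow xw.
exact: coprime_mod1 w1.
Qed.

(** Multiplying [x] by the elements of [Ohm_k] is the same as raising it to the
    powers that are 1 modulo [p ^ (lv x - k)]: this lemma and the next one
    translate cosets in the class of [x] into multipliers and back. *)
Lemma fixes_coset x k : k < lv x -> fixes x (lv x - k) -> forall u, lv u <= k -> E x (x * u).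
Proof.
move=> kx fx u uk; have [|w co E1] := @exp_exists_coprime p gT p_pr cycG pG (x * u) x.
  by apply: lvM_lt => //; apply: leq_ltn_trans kx.
rewrite E1; apply: fx => //; apply/eqP.
have := lv_ratio p_pr cycG pG x w 1 k; rewrite -E1 expg1 (mulgCa cycG x) mulgK uk.
by move/esym.
Qed.

Lemma coset_fixes x k : (forall u, lv u <= k -> E x (x * u)) -> fixes x (lv x - k).
Proof.
move=> xu w co /eqP w1; have := lv_ratio p_pr cycG pG x w 1 k; rewrite w1 expg1 => /xu.
by rewrite (mulgCa cycG (x ^+ w)) mulgA mulgV mul1g.
Qed.

(** Here the class of [z] has elements of different levels, [z] is one of the
    highest level and [h] one of the lowest.  The aim is that the class consists
    of all elements of levels from [lv h] to [lv z].  Since multipliers act on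
    the class as a whole, a multiplier that can be seen to preserve the class
    at [h] preserves it at [z], where it says more. *)
Section MultilevelClass.
Variables (z h : gT).
Hypotheses (zh : E z h) (hz : lv h < lv z).
Hypothesis min : forall v, E z v -> lv h <= lv v.
Hypothesis max : forall v, E z v -> lv v <= lv z.

Let p_gt1 : 1 < p. Proof. exact: prime_gt1. Qed.

Lemma ml_pos : 0 < lv h.
Proof.
rewrite lt0n lv_eq0 //; apply/eqP=> h1; move: zh hz; rewrite h1 => /(sr_1r SE) ->.
by rewrite ltnn.
Qed.

Lemma ml_inv_top : inv (T (lv z)).
Proof.
apply: (inv_T_max (inv_cls z)) => [|v]; rewrite ?inE //.
exact: max.
Qed.

(** An invariant subgroup that meets the class contains it. *)
Lemma ml_inv_ge i : inv (T i) -> lv h <= i -> lv z <= i.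
Proof. by rewrite -!memT => iT /(inv_mem iT); apply; rewrite Esym. Qed.

(** This subgroup is generated by the class of [h ^ p].  If that class reached
    the level of [h], the subgroup it generates would contain [z], so it would
    have an element of the level of [z]; then [z] would be equivalent to an
    element of the form [h ^ (p * v)], whose level is too low. *)
Lemma ml_inv_bot : inv (T (lv h).-1).
Proof.
have [h1|h1] := eqVneq (lv h) 1%N; first by rewrite h1; apply: inv_T0.
have hp : lv (h ^+ p) = (lv h).-1 := lvXprime p_pr cycG pG h.
have [y hy ymax] := cls_max (h ^+ p).
have iy : inv (T (lv y)).
  by apply: (inv_T_max (inv_cls (h ^+ p))) => [|v]; rewrite ?inE //; apply: ymax.
have [hly|ylh] := leqP (lv h) (lv y); last first.
  by rewrite (_ : (lv h).-1 = lv y) //; have := ymax _ (Er _); lia.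
have yz : lv z = lv y.
  apply/eqP; rewrite eqn_leq ml_inv_ge // -memT.
  by apply: (inv_mem ml_inv_top hy); rewrite memT hp; lia.
have [v co zE] := exp_exists_coprime p_pr cycG pG yz.
have Ez : E z (h ^+ p ^+ v) by rewrite Esym zE; apply: Eexp.
by have := min Ez; have := lvX p_pr cycG pG (h ^+ p) v; rewrite hp; have := ml_pos; lia.
Qed.

(** At [h], raising to the power [1 + p ^ l] is a translation by an element of
    the invariant subgroup [T (lv h - l)].  Hence [z ^+ (1 + p ^ l)] is also a
    translate, by such an element, of an element [z ^+ w] of the class; as
    [lv h < lv z], this forces [w] to be [1 + p ^ l] modulo [p ^ l.+1]. *)
Lemma ml_translate l : 0 < l -> l <= lv h -> inv (T (lv h - l)) ->
  exists w, [/\ coprime p w, w = 1 %[mod p ^ l], w != 1 %[mod p ^ l.+1] & E z (z ^+ w)].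
Proof.
move=> l0 lh iT; have co : coprime p (1 + p ^ l).
  by apply: (coprime_mod1 (e := l)) => //; rewrite modnDr.
have: h ^+ (1 + p ^ l) \in cls z * T (lv h - l).
  by rewrite expgD expg1 mem_mulg // ?inE // memT lvXp.
have iM : inv (cls z * T (lv h - l)) by apply: corr_setM => //; apply: inv_cls.
have: E (h ^+ (1 + p ^ l)) (z ^+ (1 + p ^ l)) by rewrite Esym; apply: Eexp.
move=> /(inv_mem iM) /[apply] /mulsgP[x u]; rewrite inE memT => zx uh zE.
have xz : lv x = lv z.
  have xul : lv (x * u) = lv z by rewrite -zE (lvX_coprime pG).
  rewrite -{1}(mulgK u x) lvM_lt //; rewrite lvV xul; have := ml_pos; lia.
have [w cow xE] := exp_exists_coprime p_pr cycG pG xz.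
suff e : w = 1 + p ^ l %[mod p ^ l.+1].
  exists w; rewrite -xE; split=> //.
    rewrite -(modn_dvdm w (dvdn_exp2l p (leqnSn l))) e.
    by rewrite (modn_dvdm _ (dvdn_exp2l p (leqnSn l))) modnDr.
  rewrite e -{2}[1%N]addn0 eqn_modDl mod0n -/(dvdn _ _) dvdn_Pexp2l // ltnn //.
have := lv_ratio p_pr cycG pG z w (1 + p ^ l) (lv h - l).
rewrite zE -xE invMg mulgA (mulgCa cycG) mulgA mulVg mul1g lvV uh => /esym/eqP e.
have le : l.+1 <= lv z - (lv h - l) by lia.
by rewrite -(modn_dvdm w (dvdn_exp2l p le)) e modn_dvdm // dvdn_exp2l.
Qed.

(** For [p = 2] the subgroup [T (lv h - 1)] only yields a multiplier congruent
    to 3 modulo 4, which generates too little; this subgroup supplies one that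
    is 5 modulo 8.  Modulo 2 and up to the radical, the square of the class
    detects the elements of the lowest level only, so the elements of level
    [(lv h).-1] form an invariant set. *)
Lemma ml_inv_bot2 r : set_rad (cls z) = T r -> r.+1 < lv h -> p = 2 -> inv (T (lv h - 2)).
Proof.
move=> radE rh p2.
have [h2|h2] := eqVneq (lv h) 2; first by rewrite h2; apply: inv_T0.
have radI u : (forall x, E z x -> E z (x * u)) -> lv u <= r.
  move=> xu; rewrite -memT -radE; apply/set_radP => x; rewrite !inE; exact: xu.
have zfix k : k < lv h -> fixes h (lv h - k) ->
    forall x, E z x -> forall u, lv u <= k + (lv x - lv h) -> E z (x * u).
  move=> kh fh x zx u uk; have hx := min zx.
  apply: (Etrans zx); apply: (fixes_coset (k := k + (lv x - lv h))) => //; first lia.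
  rewrite (_ : lv x - _ = lv h - k); last lia.
  by apply: fixes_cls fh; apply: Etrans zx; rewrite Esym.
have fr : fixes h (lv h - r).
  apply: coset_fixes => u; rewrite -memT -radE => /set_radP/(_ h).
  by rewrite !inE => /(_ zh); apply: Etrans; rewrite Esym.
(* Otherwise the radical would be larger, by [zfix]. *)
have nfr : ~ fixes h (lv h - r.+1).
  move=> f; have [|v vr] := @exists_lv p gT p_pr cycG pG r.+1.
    by apply: leq_trans (lv_le_logn p h); apply: ltnW.
  have := radI v; rewrite vr ltnn => H; apply/negP: isT; apply: H => x zx.
  by apply: (zfix _ rh f) => //; rewrite vr leq_addr.
have iV : inv (pth_power_support p (cls z))
  by apply: corr_pth_power_support => //; apply: inv_cls.
have hV : h ^+ p \in pth_power_support p (cls z).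
  rewrite -[h ^+ p]mulg1.
  rewrite (mem_pth_power_support p_pr cycG pG radE (ltnW rh) _ (group1 _)) ?inE //.
  apply/negP=> sub; apply: nfr; apply: coset_fixes => u; rewrite -memT => uT.
  have /(subsetP sub) : h * u \in h *: T r.+1 by rewrite mem_lcoset mulKg.
  by rewrite inE; apply: Etrans; rewrite Esym.
have Vlv y : y \in pth_power_support p (cls z) -> lv y = (lv h).-1.
  move=> yV; have [x [u [zx ur yE]]] := pth_power_support_ex p_pr cycG yV; rewrite inE in zx.
  have hx := min zx; move: (ur); rewrite radE memT => uT.
  have [xh|xh] := eqVneq (lv x) (lv h).
    by rewrite yE lvM_lt ?lvXprime ?xh //; lia.
  move: yV; have rx : r < lv x by lia.
  rewrite yE (mem_pth_power_support p_pr cycG pG radE rx _ ur) ?inE //.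
  case/negP; apply/subsetP=> _ /lcosetP[v + ->]; rewrite memT inE => vr.
  by apply: (zfix r) => //; lia.
have iT1 := ml_inv_bot.
have lvE v v' : E v v' -> lv v = (lv h).-1 -> lv v' = (lv h).-1.
  move=> vv' vh; have hl : lv (h ^+ p) = lv v by rewrite vh lvXprime.
  have [w cow wE] := exp_exists_coprime p_pr cycG pG hl.
  rewrite -(lvX_coprime pG v' cow); apply: Vlv; apply: (inv_mem iV _ hV).
  by rewrite wE; apply: Eexp.
move=> v v' vv'; rewrite !memT; have := iT1 _ _ vv'; rewrite !memT.
have := lvE _ _ vv'; have := lvE v' v; rewrite Esym => /(_ vv').
clear -h2 rh; lia.
Qed.

(** The multipliers found in [ml_translate] generate all those that are 1
    modulo [p]: one of them is enough for odd [p], two are needed for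
    [p = 2]. *)
Lemma ml_fixes1 : fixes z 1.
Proof.
have [h1|h1] := eqVneq (lv h) 1%N.
  by apply: (fixes_cls (x := h)); rewrite 1?Esym // -h1; apply: fixes_lv.
have h2 : 1 < lv h by have := ml_pos; lia.
have iT1 : inv (T (lv h - 1)) by rewrite subn1; apply: ml_inv_bot.
have [w [cow w1 nw1 zw]] := ml_translate (ltn0Sn 0) (ltnW h2) iT1.
have [p2|p2] := eqVneq p 2; last first.
  by apply: (fixes_gen (w := w)) => // pe2; rewrite pe2 in p2.
have [y radE] := subgroup_lv p_pr cycG pG (set_rad_group (cls z)).
rewrite /= in radE; have [hr|rh] := ltnP (lv y).+1 (lv h); last first.
  apply: (fixes_cls (x := h)); first by rewrite Esym.
  have -> : 1%N = (lv h - (lv h).-1)%N by lia.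
  apply: coset_fixes => u uh; apply: (Etrans (y := z)); first by rewrite Esym.
  have : u \in set_rad (cls z) by rewrite radE memT; lia.
  by move/set_radP/(_ h); rewrite !inE; apply.
have iT2 := ml_inv_bot2 radE hr p2.
have [w' [cow' w1' nw1' zw']] := ml_translate (ltn0Sn 1) h2 iT2.
have f2 : fixes z 2 by apply: (fixes_gen (w := w')).
move=> v cov v1.
(* The multipliers 3 modulo 4 are the products of [w] with those that are 1
   modulo 4. *)
have vodd : odd v by rewrite -[odd v]negbK -dvdn2 -{1}p2 -prime_coprime.
have [v4|v4] := eqVneq (v %% 4) 1%N; first by apply: f2; rewrite // p2 v4.
have v3 : v %% 4 = 3 by apply: odd_mod4.
have w3 : w %% 4 = 3.
  apply: odd_mod4; last by move: nw1; rewrite p2.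
  by rewrite -[odd w]negbK -dvdn2 -{1}p2 -prime_coprime.
have zvw : E z (z ^+ (w * v)).
  apply: f2; rewrite ?coprimeMr ?cow // p2 -modnMm w3 v3 //.
apply: Etrans zvw _; rewrite expgM Esym; exact: Eexp.
Qed.

Lemma ml_mulT x u : E z x -> lv u < lv x -> E z (x * u).
Proof.
move=> zx ux; apply: (Etrans zx); have x0 : 0 < lv x by apply: leq_ltn_trans ux.
apply: (fixes_coset (k := (lv x).-1)); first by rewrite prednK.
  by rewrite -{1}(prednK x0) subSnn; apply: fixes_cls zx ml_fixes1.
by rewrite -ltnS prednK.
Qed.

(** Compare the coefficients of the square of the class at [y] and at the
    corresponding element [z ^ w] of the highest level.  The latter only comes
    from pairs of elements of the highest level, hence is divisible by
    [p ^ (lv z).-1].  In the former the pairs of elements above the level of [h]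
    contribute a multiple of [p ^ lv h], so the number of pairs on the level
    of [h] is also one; being smaller than [p ^ lv h], it is 0. *)
Lemma ml_quotient_closed x y : E z x -> lv x = lv h -> lv y = lv h -> ~~ E z y ->
  ~~ E z (x^-1 * y).
Proof.
move=> zx xh yh zy; have Nh := hz.
have [w cow yE] := exp_exists_coprime p_pr cycG pG yh.
have N0 : 0 < lv z := leq_ltn_trans (leq0n _) hz.
pose S t := [set u in cls z | u^-1 * t \in cls z].
have memS t u : (u \in S t) = E z u && E z (u^-1 * t) by rewrite !inE.
have cardS : #|S y| = #|S (z ^+ w)|.
  have /eqP := sr_mul SE (corr_set_sum (inv_cls z)) (corr_set_sum (inv_cls z))
                 (Eexp cow zh).
  by rewrite !set_sum_mulE !natz yE eqz_nat => /eqP.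
have zwN : lv (z ^+ w) = lv z by rewrite (lvX_coprime pG).
have zzw : ~~ E z (z ^+ w).
  apply: contra zy => zzw; rewrite yE; apply: (Etrans zzw); exact: Eexp.
have dvdSN : p ^ (lv z).-1 %| #|S (z ^+ w)|.
  rewrite -(card_Ohm p_pr cycG pG (x := z)) ?leq_pred //; apply: dvdn_card_mul_closed.
  have SN u : u \in S (z ^+ w) -> lv u = lv z /\ lv (u^-1 * z ^+ w) = lv z.
    rewrite memS => /andP[zu zuw].
    have le v : E z v -> lv v = lv z \/ lv v < lv z.
      by move/max; rewrite leq_eqVlt => /orP[/eqP|]; [left | right].
    case: (le u zu) => uN.
      case: (le _ zuw) => [->//|uwN]; case/negP: zzw.
      by rewrite -(mulKVg u (z ^+ w)); apply: ml_mulT => //; rewrite uN.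
    case: (le _ zuw) => [e|uwN].
      case/negP: zzw; rewrite -(mulKVg u (z ^+ w)) (mulgCa cycG).
      by apply: ml_mulT => //; rewrite e.
    have : lv (z ^+ w) <= (lv z).-1.
      by rewrite -(mulKVg u (z ^+ w)) lvM_le // -ltnS (prednK N0).
    by rewrite zwN -ltnS (prednK N0) ltnn.
  apply/subsetP=> _ /mulsgP[u v uS + ->]; rewrite memT -ltnS (prednK N0) => vN.
  have [uN uwN] := SN u uS; move: uS; rewrite !memS => /andP[zu zuw].
  rewrite ml_mulT ?uN //= invMg -mulgA (mulgCa cycG) ml_mulT ?uwN ?lvV //.
have dvdSy : p ^ lv h %| #|S y|.
  by rewrite cardS; apply: dvdn_trans dvdSN; rewrite dvdn_exp2l // -ltnS (prednK N0).
have dvdSgt : p ^ lv h %| #|S y :\: T (lv h)|.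
  rewrite -(card_Ohm p_pr cycG pG (x := z)) ?(ltnW hz) //; apply: dvdn_card_mul_closed.
  apply/subsetP=> _ /mulsgP[u v + + ->]; rewrite memT !in_setD !memS !memT -ltnNge.
  case/and3P=> hu zu zuy vh; have vu := leq_ltn_trans vh hu.
  have uyu : lv (u^-1 * y) = lv u by rewrite lvM_lt ?lvV // yh.
  rewrite lvM_lt // -ltnNge hu ml_mulT //= invMg -mulgA (mulgCa cycG) ml_mulT //.
  by rewrite uyu lvV.
rewrite -(cardsID (T (lv h))) dvdn_addl // in dvdSy.
apply/negP=> zxy; suff : #|S y :&: T (lv h)| < p ^ lv h.
  rewrite ltnNge => /negP[]; apply: dvdn_leq dvdSy.
  by apply/card_gt0P; exists x; rewrite in_setI memS memT zx zxy xh /=.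
rewrite -(card_Ohm p_pr cycG pG (x := h)) //; apply: proper_card.
apply/properP; split; first exact: subsetIr.
exists 1; rewrite ?group1 // in_setI memS; apply/negP=> /andP[/andP[z1 _] _].
by have := min z1; rewrite lv1; have := ml_pos; case: (lv h).
Qed.

(** By the previous lemma, the elements of the class on the level of [h],
    together with those of lower level, form a subgroup. *)
Lemma ml_level x : lv x = lv h -> E z x.
Proof.
move=> xh; pose B := [set u | (lv u < lv h) || ((lv u == lv h) && E z u)].
have gB : group_set B.
  apply/group_setP; split=> [|u v]; first by rewrite inE lv1 ml_pos.
  rewrite !inE => uB vB.
  have mix a b : lv a < lv h -> (lv b == lv h) && E z b ->
      (lv (b * a) == lv h) && E z (b * a).
    by move=> ah /andP[/eqP bh zb]; rewrite lvM_lt ?bh // eqxx ml_mulT ?bh.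
  case/orP: uB => uB; case/orP: vB => vB.
  - suff: lv (u * v) <= (lv h).-1 by rewrite -ltnS prednK ?ml_pos // => ->.
    by rewrite lvM_le // -ltnS prednK ?ml_pos.
  - by rewrite (mulgCa cycG) (mix _ _ uB vB) orbT.
  - by rewrite (mix _ _ vB uB) orbT.
  case/andP: uB vB => /eqP uh zu /andP[/eqP vh zv].
  have: lv (u * v) <= lv h by rewrite lvM_le ?uh ?vh.
  rewrite leq_eqVlt => /orP[/eqP uvh|->//]; rewrite uvh eqxx /= ltnn /=.
  by apply: contraLR zv => nuv; rewrite -(mulKg u v) ml_quotient_closed.
have hB : h \in Group gB by rewrite inE eqxx zh orbT.
by have := mem_lv_le p_pr cycG pG hB (eq_leq xh); rewrite inE xh ltnn eqxx.
Qed.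

(** An element outside [T (lv h).-1] generates with its class an invariant
    subgroup that contains [h], hence [z]; so its class has an element of the
    level of [z], and all of these are equivalent to [z]. *)
Lemma ml_annulus : cls z = T (lv z) :\: T (lv h).-1.
Proof.
have z_top w : coprime p w -> E z (z ^+ w).
  move=> co; apply: (stab_cls (x := h) co); first by rewrite Esym.
  apply: (Etrans (y := z)); first by rewrite Esym.
  by apply: ml_level; rewrite (lvX_coprime pG).
have lth u : (lv u <= (lv h).-1) = (lv u < lv h) by rewrite -ltnS prednK ?ml_pos.
apply/setP=> u; rewrite in_setD !memT lth -leqNgt inE.
apply/idP/andP => [zu|[hu uz]]; first by rewrite min ?max.
have [y uy ymax] := cls_max u.
have iy : inv (T (lv y)).
  by apply: (inv_T_max (inv_cls u)) => [|v]; rewrite ?inE //; apply: ymax.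
have yz : lv y = lv z.
  apply/eqP; rewrite eqn_leq ml_inv_ge ?(leq_trans hu (ymax _ (Er u))) // andbT.
  by rewrite -memT (inv_mem ml_inv_top uy) // memT.
have [w cow yE] := exp_exists_coprime p_pr cycG pG yz.
by rewrite Esym; apply: (Etrans uy); rewrite yE Esym; apply: z_top.
Qed.

End MultilevelClass.

(** Such a class carries no information beyond the orders of its elements, so
    that all the work on similarities can be done with classes of one level. *)
Lemma multilevel_class x y : E x y -> lv x != lv y ->
  exists a b, [/\ inv (T a), inv (T b) & cls x = T b :\: T a].
Proof.
move=> xy lxy; have [z xz zmax] := cls_max x.
have := @arg_minnP _ x (E x) lv (Er x); case=> h xh hmin.
have zE v : E z v = E x v.
  apply/idP/idP => [zv|xv]; first exact: (Etrans xz zv).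
  by apply: (Etrans _ xv); rewrite Esym.
have zh : E z h by rewrite zE.
have min v : E z v -> lv h <= lv v by rewrite zE => /hmin.
have max v : E z v -> lv v <= lv z by rewrite zE => /zmax.
have hz : lv h < lv z.
  have := hmin _ (Er x); have := hmin _ xy; have := zmax _ (Er x); have := zmax _ xy.
  by move: lxy; clear; lia.
exists (lv h).-1, (lv z); split.
- exact: (ml_inv_bot zh hz min max).
- exact: (ml_inv_top max).
rewrite -(ml_annulus zh hz min max); by apply/setP=> v; rewrite !inE zE.
Qed.

End SchurPartition.

(** * Construction of the bijection *)

Lemma expg_order_ratio (gT : finGroupType) (x : gT) a b w :
  x ^+ w = x ^+ a * (x ^+ b)^-1 -> a = w + b %[mod #[x]].
Proof. by move=> e; apply/eqP; rewrite -eq_expg_mod_order expgD e mulgKV. Qed.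

Section Build.
Variables (p : nat) (gT gT' : finGroupType) (R : gT -> gT' -> bool).
Hypotheses (p_pr : prime p) (SR : schur_rel R).
Hypotheses (cycG : cyclic [set: gT]) (pG : p.-group [set: gT]).
Hypotheses (cycG' : cyclic [set: gT']) (pG' : p.-group [set: gT']).

Local Notation T i := 'Ohm_i([set: gT]).
Local Notation T' i := 'Ohm_i([set: gT']).
Local Notation lv' := (@lv p gT').
Local Notation lv := (@lv p gT).
Local Notation E := (lrel R).
Local Notation C := (cls E).
Local Notation C' x := [set y | R x y].

Let SE : schur_rel E. Proof. exact: schur_lrel. Qed.
Let Er : reflexive E. Proof. exact: lrel_refl. Qed.
Let abG := abelG cycG.
Let abG' := abelG cycG'.
Let memT i x : (x \in T i) = (lv x <= i). Proof. exact: mem_Ohm. Qed.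
Let memT' i x : (x \in T' i) = (lv' x <= i). Proof. exact: mem_Ohm. Qed.

Lemma corr_image V : corr_set E V V -> corr_set R V [set y | [exists x in V, R x y]].
Proof.
move=> iV x y xy; rewrite inE; apply/idP/existsP => [xV|[x' /andP[x'V x'y]]].
  by exists x; rewrite xV.
by rewrite (iV _ x') // (lrelE SR _ xy).
Qed.

Lemma corr_Ohm i : corr_set E (T i) (T i) -> corr_set R (T i) (T' i).
Proof.
move=> /corr_image; set V' := [set y | _] => c.
have V'E : V' = <<V'>>.
  by apply: (corr_set_uniq SR c); rewrite -[T i]genGid; apply: corr_set_gen.
have [y yE] := subgroup_lv p_pr cycG' pG' <<V'>>%G.
have [x xE] := subgroup_lv p_pr cycG pG 'Ohm_i([set: gT])%G.
rewrite /= in xE yE; have := corr_set_card SR c.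
rewrite V'E yE xE !card_Ohm_lv // => /eqP; rewrite eqn_exp2l ?prime_gt1 // => /eqP xy.
suff <- : V' = T' i by rewrite -xE.
rewrite V'E yE -xy; apply/setP=> u; rewrite !memT'.
have [|v vu] := @exists_lv p gT p_pr cycG pG (lv' u).
  by rewrite (card_schur_rel SR); apply: lv_le_logn.
by rewrite -vu -!memT xE.
Qed.

Lemma corr_cls x y : R x y -> corr_set R (C x) (C' x).
Proof.
move=> xy u v uv; rewrite !inE (lrelE SR _ xy).
by have := corr_class SR xy uv; rewrite !inE.
Qed.

Lemma Rexp w x y : coprime p w -> R x y -> R (x ^+ w) (y ^+ w).
Proof. by move=> co; apply: (schur_expg SR abG abG' (coprime_card pG co)). Qed.

(** All elements of the class are powers of [x] by multipliers that preserve the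
    class, so a coset contained in it at [x] is contained in it everywhere. *)
Lemma onelevel_rad x k : (forall v, E x v -> lv v = lv x) ->
  x *: T k \subset C x -> T k \subset set_rad (C x).
Proof.
move=> one /subsetP sub; apply/subsetP=> u; rewrite memT => uk.
apply/set_radP=> v; rewrite !inE => xv; have vx := one v xv.
have [w co vE] := exp_exists_coprime p_pr cycG pG vx.
have [|w' uE] := @exp_exists p gT p_pr cycG pG u (u ^+ w).
  by rewrite (lvX_coprime pG).
apply: (Etrans SE Er xv); rewrite vE uE -expgM mulnC expgM -(expgMa cycG).
apply: (Eexp cycG pG SE co).
have /sub : x * u ^+ w' \in x *: T k.
  by rewrite mem_lcoset mulKg memT (leq_trans (lvX p_pr cycG pG _ _)).
by rewrite inE.
Qed.

(** The values of [t] such that the map to be constructed on the subgroup of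
    level [i] generated by [x] is a homomorphism modulo [T' t].  This comes for
    free in quotients of order at most [p], and of order 4 when [p = 2];
    otherwise it is required as soon as [T t.+1] is too large for the class of
    [x] to contain all its translates of [x]. *)
Definition rigid i (x : gT) t :=
  [|| i <= t.+1, (p == 2) && (i <= t.+2) | ~~ (x *: T t.+1 \subset C x)].

(** The map [x ^+ b |-> F b] realises [R] on the subgroup generated by [x], and
    agrees modulo the appropriate subgroups with the homomorphism that sends
    [x] to [y]. *)
Definition partial_iso i (x : gT) (y : gT') (F : nat -> gT') :=
  [/\ lv x = i, lv' y = i, R x y,
      forall b c, R (x ^+ b * (x ^+ c)^-1) (F b * (F c)^-1) &
      forall t b, rigid i x t -> lv' (F b * (y ^+ b)^-1) <= t].

(** One more digit: [F] is defined on the powers of [x ^+ p], and [y] is the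
    image of [x]. *)
Definition extend (y : gT') (F : nat -> gT') b := F (b %/ p) * y ^+ (b %% p).

Lemma extend_ratio y F r b :
  (forall b, lv' (F b * (y ^+ (p * b))^-1) <= r) ->
  lv' (extend y F b * (y ^+ b)^-1) <= r.
Proof.
move=> Fr; rewrite /extend {3}(divn_eq b p) expgD invMg [(_ %/ _ * _)%N]mulnC !mulgA mulgK.
exact: Fr.
Qed.

(** For exponents in the same residue class modulo [p] this is the property of
    [F].  Otherwise the two elements differ by a generator, a power of [x] by a
    multiplier, and modulo [T' r] both sides are given by the homomorphism
    that sends [x] to [y]. *)
Lemma extend_rel i x y F r : lv x = i.+1 -> lv' y = i.+1 -> r <= i ->
  (forall b c, R ((x ^+ p) ^+ b * ((x ^+ p) ^+ c)^-1) (F b * (F c)^-1)) ->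
  (forall u, lv' u <= r -> R x (y * u)) ->
  (forall b, lv' (F b * (y ^+ (p * b))^-1) <= r) ->
  forall b c, R (x ^+ b * (x ^+ c)^-1) (extend y F b * (extend y F c)^-1).
Proof.
move=> xi yi ri RF Ry Fr b c.
have [bc|bc] := eqVneq (b %% p) (c %% p).
  have xE d : x ^+ d = (x ^+ p) ^+ (d %/ p) * x ^+ (d %% p).
    by rewrite -expgM mulnC -expgD -divn_eq.
  by rewrite /extend (xE b) (xE c) bc !invMg !mulgA !mulgK.
have xbc : lv (x ^+ b * (x ^+ c)^-1) = lv x.
  apply/eqP; rewrite eqn_leq lvM_le ?lvV ?lvX //= xi ltnNge.
  by rewrite lv_ratio // xi subSnn expn1.
have [w co wE] := exp_exists_coprime p_pr cycG pG xbc.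
have := expg_order_ratio (esym wE); rewrite (order_lv pG) xi -yi -(order_lv pG') => /eqP.
rewrite -eq_expg_mod_order expgD => /eqP yE.
pose e b := extend y F b * (y ^+ b)^-1.
have er d : lv' (e d) <= r by apply: extend_ratio.
have eE d : extend y F d = y ^+ d * e d by rewrite (mulgCa cycG') /e mulgKV.
have wr : lv' (e b * (e c)^-1) <= r by rewrite lvM_le ?lvV.
have [|k kE] := @exp_exists p gT' p_pr cycG' pG' (e b * (e c)^-1) ((e b * (e c)^-1) ^+ w).
  by rewrite (lvX_coprime pG').
have -> : extend y F b * (extend y F c)^-1 = (y * (e b * (e c)^-1) ^+ k) ^+ w.
  rewrite (expgMa cycG') -expgM mulnC expgM -kE !eE yE.
  move: (e b) (e c) => eb ec; rewrite invMg (mulgCa cycG' ec^-1) -(mulgA (y ^+ w)).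
  by rewrite (mulgCa cycG' (y ^+ c) eb) !mulgA mulgK.
rewrite wE; apply: Rexp => //; apply: Ry.
by apply: leq_trans (lvX p_pr cycG' pG' _ _) wr.
Qed.

(** With the next lemma: classes of several levels impose no condition on the image of
    [x], nor on the map already built. *)
Lemma multilevel_coset x v u : E x v -> lv x != lv v -> lv u < lv x -> E x (x * u).
Proof.
move=> xv lxv ux; have [a [b [_ _ CE]]] := multilevel_class p_pr cycG pG SE Er xv lxv.
have : x \in C x by rewrite inE.
have -> : E x (x * u) = (x * u \in C x) by rewrite inE.
by rewrite CE !in_setD !memT lvM_lt.
Qed.

Lemma multilevel_match x v y : E x v -> lv x != lv v -> lv' y = lv x -> R x y.
Proof.
move=> xv lxv yx; have [a [b [ia ib CE]]] := multilevel_class p_pr cycG pG SE Er xv lxv.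
have [y0 xy0] := sr_totl SR x.
have -> : R x y = (y \in C' x) by rewrite inE.
have cD := corr_setD (corr_Ohm ib) (corr_Ohm ia).
rewrite -CE in cD; rewrite (corr_set_uniq SR (corr_cls xy0) cD).
have : x \in C x by rewrite inE.
by rewrite CE !in_setD !memT !memT' yx.
Qed.

Lemma rad_Ohm x y r : R x y -> set_rad (C x) = T r -> set_rad (C' x) = T' r.
Proof.
move=> xy radE; have cr := corr_set_rad SR abG abG' (corr_cls xy).
have ir := corr_set_rad SE abG abG (inv_cls SE Er x).
rewrite radE in cr ir; exact: (corr_set_uniq SR cr (corr_Ohm ir)).
Qed.

(** Both classes generate the subgroup of level [lv x]. *)
Lemma onelevel_top x : (forall v, E x v -> lv v = lv x) -> exists2 y, R x y & lv' y = lv x.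
Proof.
move=> one; have [y0 xy0] := sr_totl SR x.
have genE : <<C x>> = T (lv x).
  by apply: (gen_lv_max p_pr cycG pG) => [|v]; rewrite inE // => /one->.
have cx := corr_set_gen SR (corr_cls xy0).
have iT : corr_set E (T (lv x)) (T (lv x)).
  by rewrite -genE; apply: corr_set_gen => //; apply: inv_cls.
rewrite genE in cx; have gE := corr_set_uniq SR cx (corr_Ohm iT).
have [/existsP[y /andP[xy /eqP yx]]|] := boolP [exists y, R x y && (lv' y == lv x)].
  by exists y.
rewrite negb_exists => /forallP noy.
have [x0|x0] := posnP (lv x).
  exists 1; last by rewrite lv1 x0.
  by have /eqP := x0; rewrite lv_eq0 // => /eqP->; apply: sr11.
have : <<C' x>> \subset T' (lv x).-1.
  rewrite gen_subG; apply/subsetP=> y; rewrite inE memT' => xy.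
  have := noy y; rewrite xy /= => yx; have : y \in <<C' x>> by rewrite mem_gen ?inE.
  by rewrite gE memT'; move: yx; clear; lia.
have [|y yx] := @exists_lv p gT' p_pr cycG' pG' (lv x).
  by rewrite -(card_schur_rel SR); apply: lv_le_logn.
rewrite gE => /subsetP/(_ y); rewrite !memT' yx leqnn => /(_ isT).
by rewrite -ltnS prednK // ltnn.
Qed.

(** The image [y1] of [x] has to be compatible with the image [y] of [x ^+ p],
    up to the radical [T r] of the class of [x].  Since [x ^+ p] belongs to the
    [p]-th power of this class, [y] belongs to the [p]-th power of the
    corresponding class, and this provides [y1].  There is nothing to adjust
    when the class contains the whole coset of [x] by the elements of lower
    level, in particular when the class has several levels. *)
Lemma extend_choice i x y F : lv x = i.+1 -> partial_iso i (x ^+ p) y F ->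
  exists r y1, [/\ r <= i, lv' y1 = i.+1, forall u, lv' u <= r -> R x (y1 * u),
    forall b, lv' (F b * (y1 ^+ (p * b))^-1) <= r &
    forall t, ~~ (x *: T t.+1 \subset C x) -> r <= t].
Proof.
move=> xi [xpi yi xpy RF Fy].
have [sub|nsub] := boolP (x *: T i \subset C x).
  have [y1 [y1i Ry1]] : exists y1, lv' y1 = i.+1 /\ forall u, lv' u <= i -> R x (y1 * u).
    have [/forall_inP one|] := boolP [forall v in C x, lv v == lv x].
      have {}one v : E x v -> lv v = lv x by move=> xv; apply/eqP/one; rewrite inE.
      have [y1 xy1 y1x] := onelevel_top one; exists y1; split; first by rewrite y1x.
      move=> u ui; have radi := onelevel_rad one sub.
      have [v rE] := subgroup_lv p_pr cycG pG (set_rad_group (C x)).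
      rewrite /= in rE; have rE' := rad_Ohm xy1 rE.
      have : u \in set_rad (C' x).
        rewrite rE' memT' (leq_trans ui) //; move: radi; rewrite rE.
        have [|v' <-] := @exists_lv p gT p_pr cycG pG i.
          by apply: leq_trans (lv_le_logn p x); rewrite xi.
        by move=> /subsetP/(_ v'); rewrite !memT leqnn => /(_ isT).
      by move/set_radP/(_ y1); rewrite !inE; apply.
    rewrite negb_forall_in => /exists_inP[v]; rewrite inE => xv vx.
    have [|y1 y1i] := @exists_lv p gT' p_pr cycG' pG' i.+1.
      by rewrite -(card_schur_rel SR) -xi; apply: lv_le_logn.
    exists y1; split=> // u ui; apply: multilevel_match xv _ _; rewrite 1?eq_sym //.
    by rewrite lvM_lt // y1i.
  exists i, y1; split=> // [b|t].
    rewrite lvM_le // ?lvV.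
      have := Fy i b; rewrite /rigid leqnSn => /(_ isT) h.
      rewrite -(mulgKV (y ^+ b) (F b)) lvM_le // -yi; exact: lvX.
    rewrite expgM; apply: leq_trans (lvX p_pr cycG' pG' _ _) _.
    by rewrite lvXprime // y1i.
  apply: contraR; rewrite -ltnNge => ti; apply: subset_trans sub; apply: mulgS.
  by apply/subsetP=> u; rewrite !memT => /leq_trans; apply.
have one v : E x v -> lv v = lv x.
  move=> xv; apply/eqP; apply: contraR nsub; rewrite eq_sym => vx.
  apply/subsetP=> _ /lcosetP[u + ->]; rewrite memT inE => ui.
  by apply: multilevel_coset xv vx _; rewrite xi.
have [v rE] := subgroup_lv p_pr cycG pG (set_rad_group (C x)).
move: (lv v) rE => r /= rE {v}.
have radP t : x *: T t \subset C x -> T t \subset T r.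
  by rewrite -rE; apply: onelevel_rad.
have subr t : t <= r -> T t \subset T r.
  by move=> tr; apply/subsetP=> u; rewrite !memT => /leq_trans; apply.
have ri : r < i.
  rewrite ltnNge; apply: contraNN nsub => /subr; rewrite -rE => /subsetP ir.
  apply/subsetP=> _ /lcosetP[u /ir/set_radP/(_ x) + ->]; rewrite !inE; exact.
have nsubr : ~~ (x *: T r.+1 \subset C x).
  have [|v vr] := @exists_lv p gT p_pr cycG pG r.+1.
    by apply: leq_trans (lv_le_logn p x); rewrite xi ltnW.
  by apply/negP=> /radP/subsetP/(_ v); rewrite !memT vr leqnn ltnn => /(_ isT).
have [y0 xy0] := sr_totl SR x.
have radE' := rad_Ohm xy0 rE.
have cV := corr_pth_power_support p abG abG' SR (corr_cls xy0).
have rx : r < lv x by rewrite xi ltnW.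
have xC : x \in C x by rewrite inE.
have VE : x ^+ p \in pth_power_support p (C x).
  by rewrite -[x ^+ p]mulg1 (mem_pth_power_support p_pr cycG pG rE rx xC (group1 _)).
have yV : y \in pth_power_support p (C' x) by rewrite -(cV _ _ xpy).
have [y1 [u [y1C ur yE]]] := pth_power_support_ex p_pr cycG' yV.
rewrite inE in y1C; rewrite radE' memT' in ur.
have i0 : 0 < i by apply: leq_ltn_trans ri.
have y1i : lv' y1 = i.+1.
  have : lv' (y1 ^+ p) = i.
    have uy : lv' u^-1 < lv' y by rewrite lvV yi (leq_ltn_trans ur).
    by rewrite -(mulgK u (y1 ^+ p)) -yE lvM_lt.
  by rewrite lvXprime //; move: i0; clear; lia.
exists r, y1; split=> // [|u' u'r|b|t]; first exact: ltnW.
- have /set_radP/(_ y1) : u' \in set_rad (C' x) by rewrite radE' memT'.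
  by rewrite !inE; apply.
- have -> : F b * (y1 ^+ (p * b))^-1 = (F b * (y ^+ b)^-1) * u ^+ b.
    rewrite yE (expgMa cycG') -expgM invMg (mulgCa cycG' (u ^+ b)^-1) !mulgA mulgKV //.
  rewrite lvM_le ?(leq_trans (lvX p_pr cycG' pG' _ _) ur) //; apply: Fy.
  rewrite /rigid; apply: contraT; rewrite !negb_or -!ltnNge negbK => /and3P[ir p2i sub].
  (* If [F] were not known to be linear modulo [T r], the class of [x ^+ p] would
     contain a coset of [T r.+1]; lifting it through the [p]-th power gives a
     multiplier [w] so close to 1 that its powers fill a coset of [T r.+2] in
     the class of [x]. *)
  case/negP: nsubr.
  have iV : corr_set E (pth_power_support p (C x)) (pth_power_support p (C x)).
    by apply: (corr_pth_power_support p abG abG SE); apply: inv_cls.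
  have [|v vr] := @exists_lv p gT p_pr cycG pG r.+1.
    by apply: leq_trans (lv_le_logn p x); rewrite xi ltnW.
  have xpv : E (x ^+ p) (x ^+ p * v).
    have /(subsetP sub) : x ^+ p * v \in x ^+ p *: T r.+1 by rewrite mem_lcoset mulKg memT vr.
    by rewrite inE.
  have [x1 [u1 [x1C u1r xvE]]] := pth_power_support_ex p_pr cycG (inv_mem iV xpv VE).
  rewrite inE in x1C; rewrite rE memT in u1r.
  have [w co x1E] := exp_exists_coprime p_pr cycG pG (one _ x1C).
  have ratio : (x ^+ p) ^+ w * ((x ^+ p) ^+ 1)^-1 = v * u1^-1.
    rewrite expg1 -expgM mulnC expgM -x1E -(mulgK u1 (x1 ^+ p)) -xvE.
    by rewrite (mulgCa cycG (x ^+ p)) -!mulgA (mulgCa cycG u1^-1) mulKVg.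
  have vu1 : lv (v * u1^-1) = r.+1 by rewrite lvM_lt ?lvV ?vr ?ltnS.
  have wk k := lv_ratio p_pr cycG pG (x ^+ p) w 1 k.
  rewrite ratio vu1 xpi in wk.
  have e0 : 0 < i - r.+1 by rewrite subn_gt0.
  have ir1 : (i - r.+1).+1 = i - r by rewrite subnSK.
  have fx : fixes p E x (i - r.+1).
    apply: (fixes_gen p_pr cycG pG SE Er (w := w)) => //.
    - move=> p2; move: p2i; rewrite p2 eqxx /= -ltnNge; clear -e0; lia.
    - by apply/eqP; rewrite -wk.
    - by rewrite ir1 -wk ltnn.
    by rewrite -x1E.
  apply/subsetP=> _ /lcosetP[u' + ->]; rewrite memT inE => u'r.
  apply: (fixes_coset p_pr cycG pG (k := r.+2) _ _ (leqW u'r)); first by rewrite xi ltnS.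
  by rewrite xi subSS.
by apply: contraR; rewrite -ltnNge => tr; apply/subsetP=> _ /lcosetP[u' + ->];
   move=> /(subsetP (subr _ tr)); rewrite -rE => /set_radP/(_ x); rewrite !inE; apply.
Qed.

Lemma lv_ratioX (a b : gT') n k : lv' (a * b^-1) <= k -> lv' (a ^+ n * (b ^+ n)^-1) <= k.
Proof.
by rewrite -expgVn -(expgMa cycG'); apply: leq_trans (lvX p_pr cycG' pG' _ _).
Qed.

Lemma partial_iso_step i x y F : lv x = i.+1 -> partial_iso i (x ^+ p) y F ->
  exists y1 F1, partial_iso i.+1 x y1 F1.
Proof.
move=> xi PF; have [r [y1 [ri y1i Ry Fr rt]]] := extend_choice xi PF.
have [xpi yi xpy RF Fy] := PF.
have xy1 : R x y1 by rewrite -[y1]mulg1; apply: Ry; rewrite lv1.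
exists y1, (extend y1 F); split=> //.
  exact: (extend_rel xi y1i ri RF Ry Fr).
move=> t b; case/or3P => [it|/andP[/eqP p2 it]|/rt].
- by apply: leq_trans (extend_ratio b Fr) (leq_trans ri it).
(* Here [p = 2] and [i - t <= 1]: it is enough that [w] be odd. *)
- apply: extend_ratio => c.
  have yy1 : lv' y = lv' (y1 ^+ p) by rewrite lvXprime // y1i yi.
  have [w co yE] := exp_exists_coprime p_pr cycG' pG' yy1.
  rewrite -(mulgKV (y ^+ c) (F c)) -mulgA lvM_le //.
    by apply: Fy; rewrite /rigid -(ltnS i) it.
  rewrite expgM; apply: lv_ratioX; rewrite yE -[X in _ * X^-1]expg1 lv_ratio //.
  rewrite -yy1 yi p2; have : i - t <= 1 by move: it; clear; lia.
  case: (i - t) => [|[|//]] _; first by rewrite !modn1.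
  by move: co; rewrite p2 prime_coprime // dvdn2 negbK !modn2 => ->.
by apply: leq_trans; apply: extend_ratio.
Qed.

Lemma exists_partial_iso x : exists y F, partial_iso (lv x) x y F.
Proof.
move xi: (lv x) => i; elim: i x xi => [|i IHi] x xi.
  exists 1, (fun => 1); have /eqP x1 : x == 1 by rewrite -(lv_eq0 p_pr pG) ?xi.
  split=> // [||b c|t b _]; rewrite ?lv1 // ?x1 ?expg1n ?mulgV ?lv1 //; exact: sr11.
have [|y [F PF]] := IHi (x ^+ p); first by rewrite lvXprime // xi.
exact: partial_iso_step PF.
Qed.

(** The condition says that [f] maps the translate [X * y] of a class into the
    translate by [f y] of the corresponding class. *)
Theorem schur_rel_realised :
  exists f : gT -> gT', forall x y, R (x * y^-1) (f x * (f y)^-1).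
Proof.
have /cyclicP[g gE] := cycG; have [y [F [_ _ _ RF _]]] := exists_partial_iso g.
have [e eE] : exists e : gT -> nat, forall x, x = g ^+ e x.
  apply: (fin_all_exists (P := fun x n => x = g ^+ n)) => x.
  by apply/cycleP; rewrite -gE inE.
by exists (F \o e) => u v; rewrite {1}(eE u) {1}(eE v); apply: RF.
Qed.

End Build.

(** * From similarities to relations *)

Section SimilarityRel.
Variables (gT gT' : finGroupType) (A : sring gT) (A' : sring gT').
Variable phi : similarity A A'.

Definition sim_rel (x : gT) (y : gT') :=
  [exists X in basic_sets A, (x \in X) && (y \in sim_basic phi X)].

Lemma basic_cover (T : finGroupType) (B : sring T) (x : T) :
  exists2 X, X \in basic_sets B & x \in X.
Proof.
have [/eqP cov _ _] := and3P (sring_partition B).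
have /bigcupP[X XB xX] : x \in cover (basic_sets B) by rewrite cov inE.
by exists X.
Qed.

Lemma basic_eq (T : finGroupType) (B : sring T) (X Y : {set T}) x :
  X \in basic_sets B -> Y \in basic_sets B -> x \in X -> x \in Y -> X = Y.
Proof.
have [_ triv _] := and3P (sring_partition B) => XB YB xX xY.
by rewrite -(def_pblock triv XB xX) -(def_pblock triv YB xY).
Qed.

Lemma sim_basic_mem X : X \in basic_sets A -> sim_basic phi X \in basic_sets A'.
Proof. by move=> XA; rewrite -(sim_basic_im phi); apply: imset_f. Qed.

Lemma sim_basic_surj Y :
  Y \in basic_sets A' -> exists2 X, X \in basic_sets A & Y = sim_basic phi X.
Proof. by rewrite -(sim_basic_im phi) => /imsetP. Qed.

Lemma sim_relE X x y : X \in basic_sets A -> x \in X -> sim_rel x y = (y \in sim_basic phi X).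
Proof.
move=> XA xX; apply/exists_inP/idP => [[Y YA /andP[xY yY]]|yX].
  by rewrite (basic_eq XA YA xX xY).
by exists X; rewrite ?xX.
Qed.

Lemma sim_basic1 : sim_basic phi [set 1] = [set 1].
Proof.
have one (T : finGroupType) : set_sum [set (1 : T)] = 1%R.
  by apply/ffunP=> x; rewrite !ffunE inE.
have := sim_basicE phi (sring_basic1 A).
have -> : basic_elt (sring_basic1 A) = 1%R by apply: val_inj; rewrite /= one.
rewrite rmorph1 /= -one => /ffunP e; apply/setP=> y.
have := e y; rewrite !ffunE.
by case: (y \in _); case: (y \in _).
Qed.

Lemma basic_neq0 (T : finGroupType) (B : sring T) (X : {set T}) :
  X \in basic_sets B -> exists x, x \in X.
Proof.
have [_ _ n0] := and3P (sring_partition B) => XB.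
by apply/set0Pn; apply: contraNneq n0 => <-.
Qed.

Lemma set_sum_combE (T : finGroupType) (I : finType) (P : pred I) (S : I -> {set T})
    (c : I -> int) i x :
  P i -> x \in S i -> (forall j, P j -> x \in S j -> j = i) ->
  (\sum_(j | P j) set_sum (S j) *~ c j)%R x = c i.
Proof.
move=> Pi xi uniq_i.
have E j : (set_sum (S j) *~ c j)%R x = ((x \in S j)%:R *~ c j)%R.
  have -> : ((x \in S j)%:R : int)%R = set_sum (S j) x by rewrite ffunE.
  case: (c j) => n; first by rewrite -!pmulrn zgr_mulrnE.
  by rewrite !NegzE !mulrNz -!pmulrn ffunE zgr_mulrnE.
rewrite zgr_sumE (bigD1 i) //= E xi big1 => [|j /andP[Pj ji]].
  by rewrite addr0 intz.
rewrite E; case: (boolP (x \in S j)) => [/(uniq_i j Pj) e|_]; last by rewrite mul0rz.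
by rewrite e eqxx in ji.
Qed.

(** An element of [Z[G]] that is constant on the basic sets is an element of the
    S-ring, and its image under the similarity is obtained by moving the
    coefficients from each basic set to the corresponding one. *)
Lemma sim_rel_corrP a a' :
  corr sim_rel a a' <-> exists al : A, val al = a /\ val (phi al) = a'.
Proof.
pose b (X : {set gT}) : A := insubd (0%R : A) (set_sum X).
have bE X (XA : X \in basic_sets A) : b X = basic_elt XA.
  by apply: val_inj; rewrite val_insubd set_sum_in_sring.
have vb X : X \in basic_sets A -> val (b X) = set_sum X by move=> XA; rewrite (bE X XA).
have vpb X : X \in basic_sets A -> val (phi (b X)) = set_sum (sim_basic phi X).
  by move=> XA; rewrite (bE X XA) sim_basicE.
pose lift (c : {set gT} -> int) : A := (\sum_(X in basic_sets A) b X *~ c X)%R.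
have vlift c : val (lift c) = (\sum_(X in basic_sets A) set_sum X *~ c X)%R.
  by rewrite /lift raddf_sum; apply: eq_bigr => X XA; rewrite raddfMz /= vb.
have liftE c x X : X \in basic_sets A -> x \in X -> val (lift c) x = c X.
  move=> XA xX; rewrite vlift; apply: (set_sum_combE (S := id)) => // Y YA xY.
  exact: basic_eq YA XA xY xX.
have philiftE c y X : X \in basic_sets A -> y \in sim_basic phi X ->
    val (phi (lift c)) y = c X.
  move=> XA yX; rewrite /lift !raddf_sum.
  under eq_bigr => Y YA do rewrite !raddfMz /= vpb //.
  apply: set_sum_combE => // Y YA yY; apply: (sim_basic_inj YA XA).
  by apply: basic_eq yY yX; apply: sim_basic_mem.
split=> [c|[al [<- <-]]].
  exists (lift (fun X => a (repr X))); split; apply/ffunP.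
    move=> x; have [X XA xX] := basic_cover A x; rewrite (liftE _ _ X) //.
    have [y yX] := basic_neq0 (sim_basic_mem XA).
    by rewrite (c (repr X) y) ?(c x y) ?(sim_relE _ XA) ?(mem_repr x).
  move=> y; have [Y YA yY] := basic_cover A' y; have [X XA YE] := sim_basic_surj YA.
  rewrite YE in yY; rewrite (philiftE _ _ X) //; have [x xX] := basic_neq0 XA.
  by apply: c; rewrite (sim_relE _ XA) // (mem_repr x).
have [c cE] := (sring_span A (val al)).1 (valP al).
have -> : al = lift c by apply: val_inj; rewrite vlift.
by move=> x y /exists_inP[X XA /andP[xX yX]]; rewrite (liftE _ _ X) // (philiftE _ _ X).
Qed.

Lemma sim_schur_rel : schur_rel sim_rel.
Proof.
split.
- move=> x; have [X XA xX] := basic_cover A x; have [y yX] := basic_neq0 (sim_basic_mem XA).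
  by exists y; rewrite (sim_relE _ XA).
- move=> y; have [Y YA yY] := basic_cover A' y; have [X XA YE] := sim_basic_surj YA.
  by have [x xX] := basic_neq0 XA; exists x; rewrite (sim_relE _ XA) // -YE.
- move=> x x' y y' /exists_inP[X XA /andP[xX yX]] /exists_inP[X' XA' /andP[xX' yX']].
  have XX' : X = X'.
    apply: (sim_basic_inj XA XA').
    by apply: basic_eq yX yX'; apply: sim_basic_mem.
  by rewrite (sim_relE _ XA') // (sim_relE _ XA) // XX'.
- by move=> y; rewrite (sim_relE _ (sring_basic1 A)) ?inE // sim_basic1 inE => /eqP.
- move=> x /exists_inP[X XA /andP[xX X1]]; suff XE : X = [set 1].
    by move: xX; rewrite XE inE => /eqP.
  apply: (sim_basic_inj XA (sring_basic1 A)); apply: basic_eq X1 _.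
  - exact: sim_basic_mem.
  - exact/sim_basic_mem/sring_basic1.
  by rewrite sim_basic1 inE.
move=> a b a' b' /sim_rel_corrP[al [<- <-]] /sim_rel_corrP[be [<- <-]].
by apply/sim_rel_corrP; exists (al * be)%R; rewrite !rmorphM.
Qed.

Lemma Iso_of_realisation (f : gT -> gT') :
  (forall x y, sim_rel (x * y^-1) (f x * (f y)^-1)) -> Iso phi f.
Proof.
move=> Rf; have SR := sim_schur_rel.
have f_inj : injective f.
  move=> x y e; have := Rf x y; rewrite e mulgV => /(sr_1r SR)/eqP.
  by rewrite -eq_mulgV1 => /eqP.
split; first by apply: inj_card_bij => //; rewrite (card_schur_rel SR).
move=> X y XA; apply/eqP; rewrite eqEcard card_imset // !card_rcoset.
have [x xX] := basic_neq0 XA; have [z zX] := basic_neq0 (sim_basic_mem XA).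
have xz : sim_rel x z by rewrite (sim_relE _ XA).
have cX : corr_set sim_rel X (sim_basic phi X).
  move=> u v uv; apply/idP/idP => [uX|vX]; first by rewrite -(sim_relE _ XA uX).
  have [Y YA uY] := basic_cover A u.
  have : v \in sim_basic phi Y by rewrite -(sim_relE _ YA uY).
  move=> vY; suff -> : X = Y by [].
  apply: (sim_basic_inj XA YA); apply: basic_eq vX vY; exact: sim_basic_mem.
rewrite (corr_set_card SR cX) leqnn andbT; apply/subsetP=> _ /imsetP[u uXy ->].
by rewrite mem_rcoset -(cX _ _ (Rf u y)) -mem_rcoset.
Qed.

End SimilarityRel.

Theorem theorem1p3 (p : nat) (p_prime : prime p) (gT : finGroupType)
  (cycG : cyclic [set: gT]) (pG : p.-group [set: gT]) (A : sring gT) :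
  separable_sring A.
Proof.
move=> gT' A' phi cycG'; have SR := sim_schur_rel phi.
have pG' : p.-group [set: gT'] by rewrite /pgroup cardsT -(card_schur_rel SR) -cardsT.
have [f fR] := schur_rel_realised p_prime SR cycG pG cycG' pG'.
by exists f; apply: Iso_of_realisation.
Qed.
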